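(* Let $g\in H^{-1/2}(\partial\Omega)$ with $\langle g,1\rangle=0$. For each $n\in\mathbb{N}$ let $w_n^{\alpha_n}\in H^1(\Omega)/\mathbb{R}$ be the solution of $$\nabla\cdot(\alpha_n\nabla w_n^{\alpha_n})=0\ \text{in }\Omega,\qquad \alpha_n\frac{\partial w_n^{\alpha_n}}{\partial n}=g\ \text{on }\partial\Omega,$$ and let $w^\alpha\in H^1(\Omega)/\mathbb{R}$ be the solution of $$-\nabla\cdot(\alpha\nabla w^\alpha)=0\ \text{in }\Omega,\qquad \alpha\frac{\partial w^\alpha}{\partial n}=g\ \text{on }\partial\Omega.$$ Then $w_n^{\alpha_n}\rightharpoonup w^\alpha$ weakly in $H^1(\Omega)/\mathbb{R}$ as $n\to\infty$, and in addition $$\int_\Omega\alpha_n|\nabla w_n^{\alpha_n}|^2\,dx\longrightarrow\int_\Omega\alpha|\nabla w^\alpha|^2\,dx.$$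
   Context: $\Omega\subset\mathbb{R}^N$ ($N=2,3$) is a bounded domain with Lipschitz boundary, $0<b<c<\infty$, and $L^\infty(\Omega,[b,c])$ is the set of functions in $L^\infty(\Omega)$ with values in $[b,c]$ a.e. Standing assumption on the conductivities: $\alpha_n,\alpha\in L^\infty(\Omega,[b,c])$ with $\alpha_n\to\alpha$ strongly in $L^1(\Omega)$ and $\alpha_n\rightharpoonup\alpha$ weakly$^\ast$ in $L^\infty(\Omega)$. $\partial/\partial n$ in a boundary condition denotes the outer normal derivative; $\langle\cdot,\cdot\rangle$ is the duality pairing of $H^{-1/2}(\partial\Omega)$ and $H^{1/2}(\partial\Omega)$. Boundary value problems are understood in the weak sense, Neumann solutions being determined up to an additive constant, i.e. as elements of $H^1(\Omega)/\mathbb{R}$. *)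

(* Defs.v *)
From HB Require Import structures.
From mathcomp Require Import all_boot all_order all_algebra.
From mathcomp Require Import all_classical all_reals all_analysis.
Set Implicit Arguments.
Unset Strict Implicit.
Unset Printing Implicit Defensive.
Import Order.TTheory GRing.Theory Num.Theory.
Import numFieldNormedType.Exports.
Local Open Scope classical_set_scope.
Local Open Scope ring_scope.

Fact rV_display : measure_display -> measure_display.
Proof. exact. Qed.

Section rV_measurable.
Context (R : realType) (N : nat).

Let coord (i : 'I_N) (x : 'rV[R]_N) : R := x ord0 i.

Let rV_set0 : g_sigma_preimage coord set0.
Proof. exact: sigma_algebra0. Qed.

Let rV_setC A : g_sigma_preimage coord A -> g_sigma_preimage coord (~` A).
Proof. exact: sigma_algebraC. Qed.

Let rV_bigcup (F : (set 'rV[R]_N)^nat) :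
  (forall i, g_sigma_preimage coord (F i)) ->
  g_sigma_preimage coord (\bigcup_i (F i)).
Proof. exact: sigma_algebra_bigcup. Qed.

(* The sigma-algebra generated by the coordinates: the Borel sets of R^N. *)
HB.instance Definition _ := @isMeasurable.Build (rV_display default_measure_display)
  'rV[R]_N (g_sigma_preimage coord) rV_set0 rV_setC rV_bigcup.

Lemma measurable_coord (i : 'I_N) :
  measurable_fun [set: 'rV[R]_N] (fun x : 'rV[R]_N => x ord0 i).
Proof.
move=> _ Y mY; rewrite setTI; apply: sub_sigma_algebra => /=.
rewrite -bigcup_seq/=; exists i => /=; first by rewrite mem_index_enum.
by exists Y => //; rewrite setTI.
Qed.

Lemma measurable_fun_coordP d (T : measurableType d) (f : T -> 'rV[R]_N) :
  (forall i, measurable_fun [set: T] (fun x => f x ord0 i)) ->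
  measurable_fun [set: T] f.
Proof.
move=> mf _ Y mY; rewrite setTI.
suff sub : g_sigma_preimage coord `<=` [set A | measurable (f @^-1` A)].
  exact: sub.
apply: smallest_sub.
  split => /=.
  - by rewrite preimage_set0.
  - by move=> A mA; rewrite setTD preimage_setC; exact: measurableC.
  - by move=> F mF; rewrite preimage_bigcup; exact: bigcupT_measurable.
rewrite -bigcup_seq => A [i _ [B mB <-]] /=.
by rewrite setTI -[X in measurable X]setTI; exact: mf.
Qed.

End rV_measurable.

Section lebesgue_rV_step.
Context (R : realType) (N : nat).

Definition rV_cons (p : measurableTypeR R * 'rV[R]_N) : 'rV[R]_N.+1 :=
  row_mx (p.1 : R)%:M p.2 : 'rV[R]_(1 + N).

Let rV_uncons (x : 'rV[R]_N.+1) : measurableTypeR R * 'rV[R]_N :=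
  (x ord0 ord0, rsubmx (x : 'rV[R]_(1 + N))).

Lemma measurable_rV_cons : measurable_fun setT rV_cons.
Proof.
apply: measurable_fun_coordP => i.
case: (split_ordP (i : 'I_(1 + N))) => j ->.
- rewrite (_ : (fun x => _) = fst); first exact: measurable_fst.
  apply/funext => x; rewrite /rV_cons; apply: etrans; first exact: row_mxEl.
  by rewrite !ord1 mxE mulr1n.
- rewrite (_ : (fun x => _) = (fun x : 'rV[R]_N => x ord0 j) \o snd); last first.
    by apply/funext => x; exact: row_mxEr.
  by apply: measurableT_comp; [exact: measurable_coord|exact: measurable_snd].
Qed.

Let measurable_rV_uncons : measurable_fun setT rV_uncons.
Proof.
apply/measurable_fun_pairP; split => /=.
  exact: (@measurable_coord R N.+1 ord0).
apply: measurable_fun_coordP => i; rewrite (_ : (fun x => _) =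
    (fun x : 'rV[R]_N.+1 => x ord0 (rshift 1 i))).
  exact: measurable_coord.
by apply/funext => x; rewrite /= mxE.
Qed.

Let rV_consK : cancel rV_cons rV_uncons.
Proof.
move=> [a v]; rewrite /rV_uncons /rV_cons; congr pair; last exact: row_mxKr.
rewrite (_ : ord0 = lshift N (ord0 : 'I_1) :> 'I_(1 + N)); last exact/val_inj.
by apply: etrans; [exact: row_mxEl|rewrite mxE mulr1n].
Qed.

Let rV_unconsK : cancel rV_uncons rV_cons.
Proof.
move=> x; apply: etrans; last exact: (@hsubmxK R 1 1 N x).
rewrite /rV_cons /rV_uncons /=; congr (@row_mx R 1 1 N _ _).
apply/matrixP => i j; rewrite !ord1 !mxE mulr1n.
by congr (x _ _); exact/val_inj.
Qed.

Context (m : {sigma_finite_measure set 'rV[R]_N -> \bar R}).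

Definition lebesgue_rV_succ : set 'rV[R]_N.+1 -> \bar R :=
  pushforward (@lebesgue_measure R \x m)%E rV_cons.

Let lebesgue_rV_succ0 : lebesgue_rV_succ set0 = 0%E.
Proof. by rewrite /lebesgue_rV_succ /pushforward preimage_set0 measure0. Qed.

Let lebesgue_rV_succ_ge0 A : (0 <= lebesgue_rV_succ A)%E.
Proof. by rewrite /lebesgue_rV_succ /pushforward measure_ge0. Qed.

Let mpre A : measurable A -> measurable (rV_cons @^-1` A).
Proof. by move=> mA; rewrite -[X in measurable X]setTI; exact: measurable_rV_cons. Qed.

Let lebesgue_rV_succ_sigma_additive : semi_sigma_additive lebesgue_rV_succ.
Proof.
move=> F mF tF mUF; rewrite /lebesgue_rV_succ /pushforward preimage_bigcup.
apply: measure_semi_sigma_additive.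
- by move=> n; exact: mpre.
- apply/trivIsetP => /= i j _ _ ij; rewrite -preimage_setI.
  by move/trivIsetP : tF => /(_ _ _ _ _ ij) ->//; rewrite preimage_set0.
- by rewrite -preimage_bigcup; exact: mpre.
Qed.

HB.instance Definition _ := isMeasure.Build _ _ _ lebesgue_rV_succ
  lebesgue_rV_succ0 lebesgue_rV_succ_ge0 lebesgue_rV_succ_sigma_additive.

Let lebesgue_rV_succ_sigma_finite : sigma_finite setT lebesgue_rV_succ.
Proof.
have /sigma_finiteP[F [TF ndF Foo]] := sigma_finiteT (@lebesgue_measure R).
have /sigma_finiteP[G [TG ndG Goo]] := sigma_finiteT m.
exists (fun n => rV_uncons @^-1` (F n `*` G n)).
  rewrite -preimage_bigcup [X in preimage _ X](_ : _ = setT) ?preimage_setT//.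
  apply/seteqP; split => // -[x y] _.
  have [n _ Fnx] : (\bigcup_n F n) x by rewrite -TF.
  have [k _ Gky] : (\bigcup_n G n) y by rewrite -TG.
  exists (maxn n k) => //; split.
  - by move: x Fnx; exact/subsetPset/ndF/leq_maxl.
  - by move: y Gky; exact/subsetPset/ndG/leq_maxr.
move=> n; have [mF Fnoo] := Foo n; have [mG Gnoo] := Goo n; split.
  rewrite -[X in measurable X]setTI.
  by apply: measurable_rV_uncons => //; exact: measurableX.
rewrite /lebesgue_rV_succ /pushforward -comp_preimage.
rewrite (_ : rV_uncons \o rV_cons = id); last exact/funext.
by rewrite preimage_id product_measure1E// lte_mul_pinfty// ge0_fin_numE.
Qed.

HB.instance Definition _ := Measure_isSigmaFinite.Build _ _ _ lebesgue_rV_succ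
  lebesgue_rV_succ_sigma_finite.

End lebesgue_rV_step.

(* Lebesgue measure on R^N, as an iterated product of the one-dimensional
   Lebesgue measure, transported along R * R^N = R^(N+1). *)
Fixpoint lebesgue_rV (R : realType) (N : nat) :
    {sigma_finite_measure set 'rV[R]_N -> \bar R} :=
  if N is N'.+1 then lebesgue_rV_succ (lebesgue_rV R N')
  else \d_(0 : 'rV[R]_0).

(* Euclidean norm; the library norm on row vectors is the sup norm. *)
Definition enorm (R : realType) (N : nat) (x : 'rV[R]_N) : R :=
  Num.sqrt (\sum_i x ord0 i ^+ 2).

Section hausdorff.
Context (R : realType) (N s : nat).

Definition ediam (A : set 'rV[R]_N) : \bar R :=
  ereal_sup [set z | exists x y, [/\ A x, A y & z = (enorm (x - y))%:E]].

(* The infinite value rules out pieces of diameter > delta. *)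
Definition hausdorff_gauge (delta : R) (A : set 'rV[R]_N) : \bar R :=
  if A == set0 then 0%E
  else if (ediam A <= delta%:E)%E then (ediam A ^+ s)%E else +oo%E.

Let gauge0 delta : hausdorff_gauge delta set0 = 0%E.
Proof. by rewrite /hausdorff_gauge eqxx. Qed.

Let gauge_ge0 delta A : (0 <= hausdorff_gauge delta A)%E.
Proof.
rewrite /hausdorff_gauge; case: ifPn => // /set0P[x Ax]; case: ifPn => // _.
apply: expe_ge0; apply: ereal_sup_ubound => /=; exists x, x; split => //.
rewrite subrr /enorm big1 ?sqrtr0// => i _.
by rewrite mxE expr0n.
Qed.

(* s-dimensional Hausdorff outer measure on R^N, without the dimensional
   normalisation factor. [mu_ext] takes the infimum over countable covers by
   Borel sets, which loses nothing since a set and its closure have the same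
   diameter. *)
Definition hausdorff (A : set 'rV[R]_N) : \bar R :=
  ereal_sup [set mu_ext (hausdorff_gauge delta) A | delta in [set d | 0 < d]].

Let hausdorff0 : hausdorff set0 = 0%E.
Proof.
rewrite /hausdorff (_ : image _ _ = [set 0%E]) ?ereal_sup1//.
apply/seteqP; split => [_ [d _ <-]|_ ->] /=; first exact: mu_ext0.
by exists 1; [exact: ltr01|exact: mu_ext0].
Qed.

Let hausdorff_ge0 A : (0 <= hausdorff A)%E.
Proof.
apply: (@le_trans _ _ (mu_ext (hausdorff_gauge 1) A)); first exact: mu_ext_ge0.
by apply: ereal_sup_ubound; exists 1 => //=; exact: ltr01.
Qed.

Let le_hausdorff : {homo hausdorff : A B / A `<=` B >-> (A <= B)%E}.
Proof.
move=> A B AB; apply: ge_ereal_sup => _ [d /= d0 <-].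
apply: (@le_trans _ _ (mu_ext (hausdorff_gauge d) B)); first exact: le_mu_ext.
by apply: ereal_sup_ubound; exists d.
Qed.

Let hausdorff_sigma_subadditive : sigma_subadditive hausdorff.
Proof.
move=> F; apply: ge_ereal_sup => _ [d /= d0 <-].
apply: (le_trans (mu_ext_sigma_subadditive (gauge_ge0 d) F)).
apply: lee_nneseries => [i _ _|i _]; first exact: mu_ext_ge0.
by apply: ereal_sup_ubound; exists d.
Qed.

HB.instance Definition _ := isOuterMeasure.Build R 'rV[R]_N hausdorff
  hausdorff0 hausdorff_ge0 le_hausdorff hausdorff_sigma_subadditive.

End hausdorff.

Definition hausdorff_outer (R : realType) (N s : nat) :
  {outer_measure set 'rV[R]_N -> \bar R} := @hausdorff R N s.

(* Surface measure on hypersurfaces of R^N: the (N-1)-dimensional Hausdorff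
   measure, on its Caratheodory sigma-algebra; the missing normalisation factor
   affects neither the boundary values nor the norm of H^(1/2) below. *)
Definition surface (R : realType) (N : nat) :
    {measure set (caratheodory_type (hausdorff_outer R N N.-1)) -> \bar R} :=
  hausdorff_outer R N N.-1.

Definition boundary (T : topologicalType) (A : set T) : set T :=
  closure A `\` A^°.

(* Near each boundary point, after an orthogonal change of coordinates
   y = x *m Q, the set is the strict supergraph, along the i-th axis, of a
   Lipschitz function of the other N - 1 coordinates. *)
Definition lipschitz_boundary (R : realType) (N : nat) (A : set 'rV[R]_N) :=
  forall x0, boundary A x0 ->
  exists (r : R) (Q : 'M[R]_N) (i : 'I_N) (f : 'rV[R]_N.-1 -> R) (L : R),
    [/\ 0 < r, Q *m Q^T = 1%:M,
        forall y z, `|f y - f z| <= L * enorm (y - z) &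
        forall x, enorm (x - x0) < r ->
          (A x <-> f (col' i (x *m Q)) < (x *m Q) ord0 i)].

Definition domain (T : topologicalType) (A : set T) :=
  [/\ A !=set0, open A & connected A].

Definition square_integrable d (T : measurableType d) (R : realType)
    (mu : {measure set T -> \bar R}) (D : set T) (f : T -> R) :=
  measurable_fun D f /\ (\int[mu]_(x in D) (f x ^+ 2)%:E < +oo)%E.

Section functions_on_RN.
Context (R : realType) (N : nat).
Implicit Types (u v w f g t alpha : 'rV[R]_N -> R) (i : 'I_N) (x : 'rV[R]_N).

Definition partial i f : 'rV[R]_N -> R := 'D_(delta_mx ord0 i) f.

Fixpoint Ck (k : nat) f : Prop :=
  continuous f /\
  if k is k'.+1 then
    forall i, (forall x, derivable f x (delta_mx ord0 i)) /\ Ck k' (partial i f)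
  else True.

Definition smooth f := forall k, Ck k f.

Section Omega.
Context (Omega : set 'rV[R]_N).
Let leb := lebesgue_rV R N.

Definition test_function f :=
  [/\ smooth f, compact (closure [set x | f x != 0]) &
      closure [set x | f x != 0] `<=` Omega].

Definition is_weak_partial i u g :=
  forall f, test_function f ->
    \int[leb]_(x in Omega) (u x * partial i f x) =
    - \int[leb]_(x in Omega) (g x * f x).

Definition L2 u := square_integrable leb Omega u.

(* Elements of the Lebesgue and Sobolev spaces are represented by Borel
   functions; every notion below is invariant under a.e. equality. *)
Definition H1 u := L2 u /\ forall i, exists g, L2 g /\ is_weak_partial i u g.

(* The i-th weak derivative, unique up to null sets. *)
Definition weak_partial i u : 'rV[R]_N -> R :=
  xget (cst 0) [set g | L2 g /\ is_weak_partial i u g].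

Definition grad_dot u v x : R :=
  \sum_i weak_partial i u x * weak_partial i v x.

Definition H1_norm u : R :=
  Num.sqrt (\int[leb]_(x in Omega) (u x ^+ 2) +
            \int[leb]_(x in Omega) grad_dot u u x).

(* Quotient norm of H1 / R, on representatives. *)
Definition H1R_norm u : R :=
  inf [set H1_norm (fun x => u x - c) | c in [set: R]].

(* Bounded linear functionals on H1 / R, as functions of a representative:
   boundedness for the quotient norm makes them constant on classes. *)
Definition H1R_dual (l : ('rV[R]_N -> R) -> R) :=
  (forall (a : R) u v, H1 u -> H1 v ->
     l (fun x => a * u x + v x) = a * l u + l v) /\
  (exists C : R, forall u, H1 u -> `|l u| <= C * H1R_norm u).

Definition weakly_cvg_H1R (w_ : nat -> 'rV[R]_N -> R) w :=
  forall l, H1R_dual l -> l (w_ n) @[n --> \oo] --> l w.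

(* t is the trace of u: for some sequence of smooth functions tending to u in
   H1, the boundary values tend to t in L2 of the boundary. *)
Definition is_trace u t :=
  square_integrable (@surface R N) (boundary Omega) t /\
  exists f_ : nat -> 'rV[R]_N -> R,
    [/\ forall n, smooth (f_ n),
        H1_norm (fun x => f_ n x - u x) @[n --> \oo] --> 0 &
        (\int[@surface R N]_(x in boundary Omega) ((f_ n x - t x) ^+ 2)%:E
           @[n --> \oo] --> 0)%E].

Definition trace u : 'rV[R]_N -> R := xget (cst 0) [set t | is_trace u t].

(* H^(1/2) of the boundary is the range of the trace on H1, with the quotient
   norm. *)
Definition Hhalf t := exists2 u, H1 u & is_trace u t.

Definition Hhalf_norm t : R :=
  inf [set H1_norm u | u in [set u | H1 u /\ is_trace u t]].

(* H^(-1/2): the dual of H^(1/2); the duality pairing <g, t> is g t. *)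
Definition Hmhalf (g : ('rV[R]_N -> R) -> R) :=
  (forall (a : R) t1 t2, Hhalf t1 -> Hhalf t2 ->
     g (fun x => a * t1 x + t2 x) = a * g t1 + g t2) /\
  (exists C : R, forall t, Hhalf t -> `|g t| <= C * Hhalf_norm t).

Definition Linfty_between (b c : R) alpha :=
  measurable_fun Omega alpha /\
  {ae leb, forall x, Omega x -> b <= alpha x <= c}.

Definition cvg_L1 (f_ : nat -> 'rV[R]_N -> R) f :=
  (\int[leb]_(x in Omega) `|f_ n x - f x|%:E @[n --> \oo] --> 0)%E.

Definition weak_star_cvg_Linfty (f_ : nat -> 'rV[R]_N -> R) f :=
  forall h, leb.-integrable Omega (EFin \o h) ->
    \int[leb]_(x in Omega) (f_ n x * h x) @[n --> \oo] -->
    \int[leb]_(x in Omega) (f x * h x).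

(* Weak form of div (alpha grad w) = 0 in Omega, alpha dw/dn = g on the
   boundary; w represents a class of H1 / R. *)
Definition neumann_solution alpha (g : ('rV[R]_N -> R) -> R) w :=
  H1 w /\
  forall v, H1 v ->
    \int[leb]_(x in Omega) (alpha x * grad_dot w v x) = g (trace v).

End Omega.
End functions_on_RN.

(* Main.v *)
(* Both weak formulations have the right-hand side g (trace v), so
   \int alpha_n grad w_n . grad v = \int alpha grad w . grad v for every v in H1.
   Testing with v = w_n - w gives, by Cauchy-Schwarz,
     b |grad (w_n - w)|_2 <= |(alpha - alpha_n) grad w|_2,
   and the right-hand side tends to 0: the weights alpha - alpha_n are bounded
   and tend to 0 in L^1, and |grad w|^2 is integrable. Hence the gradients
   converge strongly, and the Poincare-Wirtinger inequality turns this into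
   convergence in H1/R. The energies are \int alpha grad w . grad w_n, which
   are continuous in grad w_n.

   Poincare-Wirtinger: on a cube it follows from the translation estimate
     |u(. + z) - u|_2 <= |z| |grad u|_2
   by averaging over translations. A piece of Omega near the boundary is
   translated along the axis of the local graph into the interior, which the same
   estimate controls. Finally the compact closure of Omega is covered by finitely
   many such pieces and cubes, and connectedness links them by chains of
   overlapping cubes, along which the subtracted constants are compared. *)
Require Import Defs.
From HB Require Import structures.
From mathcomp Require Import all_boot all_order all_algebra.
From mathcomp Require Import all_classical all_reals all_analysis.
From mathcomp Require Import measurable_realfun ring lra.
Set Implicit Arguments.
Unset Strict Implicit.
Unset Printing Implicit Defensive.
Import Order.TTheory GRing.Theory Num.Theory.
Import numFieldNormedType.Exports.
Local Open Scope classical_set_scope.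
Local Open Scope ring_scope.

(** * Lebesgue measure on row vectors *)

Section rV_lebesgue.
Context (R : realType).

(** Functions of H1 are never approximated by smooth ones. The translation estimate is obtained by
    duality: a bound on the pairings of h with all test functions bounds the L2 norm of h, because
    test functions are dense in L2. This density, which also yields the uniqueness of weak
    derivatives, rests on an explicit algebra of smooth functions built from exp (- 1 / x), stable
    under sums, products, partial derivatives and translations. For integrals, Cauchy-Schwarz takes
    the form of Young's inequality with a free parameter, so that square roots enter only with the
    norm of H1/R. Since [weak_partial] is a chosen representative, gradients are linear only almost
    everywhere, and identities between them are used under the integral. *)

Definition cube (N : nat) (a : 'rV[R]_N) (r : R) : set 'rV[R]_N :=
  [set x | forall i, `|x ord0 i - a ord0 i| < r].

Definition closed_cube (N : nat) (a : 'rV[R]_N) (r : R) : set 'rV[R]_N :=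
  [set x | forall i, `|x ord0 i - a ord0 i| <= r].

Lemma ball_cube N (a : 'rV[R]_N) (r : R) : 0 < r -> ball a r = cube a r.
Proof.
move=> r0; apply/seteqP; split => x /=.
  by move=> [_ H] i; move: (H ord0 i); rewrite /ball/= distrC.
by move=> H; split => // i j; rewrite ord1 /ball/= distrC; exact: H.
Qed.

Lemma measurable_cube N (a : 'rV[R]_N) (r : R) : measurable (cube a r).
Proof.
rewrite (_ : cube a r = \big[setI/setT]_(i < N)
    ((fun x : 'rV[R]_N => x ord0 i) @^-1` ball (a ord0 i) r)).
  apply: bigsetI_measurable => i _; rewrite -[X in measurable X]setTI.
  by apply: measurable_coord => //; exact: measurable_ball.
apply/seteqP; split => x /=.
  by move=> H; elim/big_rec : _ => // i A _ ?; split => //=; rewrite /ball/= distrC.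
move=> H i; move: H; rewrite (bigD1 i)//= => -[+ _].
by rewrite /ball/= distrC.
Qed.

Lemma rV_rat_dense N (x : 'rV[R]_N) (e : R) : 0 < e ->
  exists q : 'rV[rat]_N, cube (map_mx ratr q) e x.
Proof.
move=> e0.
have /choice[q qP] (i : 'I_N) : exists q : rat, `|x ord0 i - ratr q| < e.
  have [||y [/= xy [q _ qy]]] := @dense_rat R (ball (x ord0 i) e).
  - by exists (x ord0 i); exact: ballxx.
  - exact: ball_open.
  by exists q; rewrite qy.
by exists (\row_i q i) => i /=; rewrite !mxE.
Qed.

(* Closed cubes of the cover lie in A: this makes the bump functions built on
   them compactly supported in A. *)
Lemma open_cube_cover N (A : set 'rV[R]_N) : open A -> A !=set0 ->
  exists (a : nat -> 'rV[R]_N) (r : nat -> R),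
    [/\ forall j, 0 < r j,
        forall j, closed_cube (a j) (r j) `<=` A &
        A = \bigcup_j cube (a j) (r j)].
Proof.
move=> oA [x0 Ax0].
have key x : A x -> exists p : 'rV[rat]_N * nat,
    cube (map_mx ratr p.1) p.2.+1%:R^-1 x /\
    closed_cube (map_mx ratr p.1) p.2.+1%:R^-1 `<=` A.
  move=> Ax; have /nbhs_ballP[e /= e0 eA] := open_nbhs_nbhs (conj oA Ax).
  rewrite ball_cube// in eA.
  (* Radius below e / 2, and a rational centre within that radius of x: the closed cube then stays
     at distance less than e from x. *)
  have /ltr_add_invr[k] : 0 < e / 2 by rewrite divr_gt0.
  rewrite add0r => ke.
  have [q xq] := @rV_rat_dense _ x k.+1%:R^-1 ltac:(by rewrite invr_gt0).
  exists (q, k); split => //= y yq; apply: eA => i.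
  have := xq i; have := yq i.
  move=> h1 h2; apply: (le_lt_trans (ler_distD (map_mx ratr q ord0 i) _ _)).
  rewrite (splitr e) ler_ltD//; last by rewrite distrC (lt_trans h2).
  by rewrite (le_trans h1)// ltW.
have [p0 [_ p0A]] := key _ Ax0.
pose good (p : 'rV[rat]_N * nat) :=
  closed_cube (map_mx ratr p.1 : 'rV[R]_N) p.2.+1%:R^-1 `<=` A.
(* Indices that decode to no good pair fall back on [p0]: every term of the sequence is good, and
   every good pair occurs. *)
pose f j := if unpickle j is Some p then if `[< good p >] then p else p0 else p0.
have gf j : good (f j).
  by rewrite /f; case: (unpickle j) => // p; case: asboolP.
exists (fun j => map_mx ratr (f j).1), (fun j => (f j).2.+1%:R^-1); split.
- by move=> j; rewrite invr_gt0.
- by move=> j; exact: gf.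
- apply/seteqP; split => x.
    move=> /key[p [xp gp]]; exists (pickle p) => //.
    by rewrite /f pickleK; case: asboolP.
  by move=> [j _ xj]; apply: (gf j) => i; apply/ltW/xj.
Qed.

Lemma open_rV_measurable N (A : set 'rV[R]_N) : open A -> measurable A.
Proof.
have [->//|A0] := eqVneq A set0.
move=> oA; have [|a [r [_ _ ->]]] := open_cube_cover oA; first exact/set0P.
by apply: bigcupT_measurable => j; exact: measurable_cube.
Qed.

Lemma continuous_rV_measurable N (f : 'rV[R]_N -> R) :
  continuous f -> measurable_fun setT f.
Proof.
move=> /continuousP cf; apply: (measurability _ (RGenOpens.measurableE R)) => //.
move=> _ [_ [a [b ->] <-]]; rewrite setTI; apply: open_rV_measurable.
by apply: cf; exact: interval_open.
Qed.

Lemma rV_cons_ord0 N x (y : 'rV[R]_N) : rV_cons (x, y) ord0 ord0 = x :> R.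
Proof.
rewrite (_ : ord0 = lshift N (ord0 : 'I_1) :> 'I_(1 + N)); last exact/val_inj.
by apply: etrans; [exact: row_mxEl|rewrite mxE mulr1n].
Qed.

Lemma rV_cons_rshift N x (y : 'rV[R]_N) i :
  rV_cons (x, y) ord0 (rshift 1 i) = y ord0 i.
Proof. exact: row_mxEr. Qed.

Lemma lebesgue_rV_cube N (a : 'rV[R]_N) (r : R) : 0 < r ->
  lebesgue_rV R N (cube a r) = ((r *+ 2) ^+ N)%:E.
Proof.
move=> r0; elim: N a => [|N IH] a.
  rewrite /= diracE expr0.
  by rewrite mem_set // => -[].
rewrite /= /lebesgue_rV_succ /pushforward.
rewrite (_ : _ @^-1` _ = ball (a ord0 ord0) r `*`
    cube (rsubmx (a : 'rV[R]_(1 + N))) r).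
  rewrite product_measure1E//=; [|exact: measurable_ball|exact: measurable_cube].
  by rewrite IH lebesgue_measure_ball ?ltW// -EFinM exprS.
apply/seteqP; split => -[x y] /=.
  move=> H; split => /=; first by have := H ord0; rewrite rV_cons_ord0 /ball/= distrC.
  by move=> i; have := H (rshift 1 i); rewrite rV_cons_rshift mxE.
rewrite /ball/= distrC => -[H1 H2] i.
case: (split_ordP (i : 'I_(1 + N))) => j ->.
  have -> : lshift N j = ord0 by apply/val_inj; rewrite /= ord1.
  by rewrite rV_cons_ord0.
by rewrite rV_cons_rshift; have := H2 j; rewrite mxE.
Qed.

Lemma lebesgue_rV_bounded N (A : set 'rV[R]_N) : measurable A -> bounded_set A ->
  (lebesgue_rV R N A < +oo)%E.
Proof.
move=> mA [M0 [_ /(_ (M0 + 1))]]; rewrite ltrDl ltr01 => /(_ isT).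
set M := M0 + 1 => AM.
have sub : A `<=` cube 0 (`|M| + 1).
  move=> x Ax i; rewrite mxE subr0.
  have : ball_ (fun x : 'rV[R]_N => `|x|) 0 (`|M| + 1) x.
    rewrite /ball_/= sub0r normrN (le_lt_trans (AM _ Ax))//.
    by rewrite (le_lt_trans (ler_norm _))// ltrDl.
  by rewrite -mx_norm_ball => -[_ /(_ ord0 i)]; rewrite /ball/= mxE sub0r normrN.
have Mgt0 : 0 < `|M| + 1 by rewrite ltr_pwDr.
apply: (@le_lt_trans _ _ (lebesgue_rV R N (cube 0 (`|M| + 1)))).
  by apply: le_measure; rewrite ?inE//; exact: measurable_cube.
by rewrite lebesgue_rV_cube// ltry.
Qed.

Lemma lebesgue_rV_open_gt0 N (A : set 'rV[R]_N) : open A -> A !=set0 ->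
  (0 < lebesgue_rV R N A)%E.
Proof.
move=> oA [x Ax]; have /nbhs_ballP[e /= e0 eA] := open_nbhs_nbhs (conj oA Ax).
rewrite ball_cube// in eA.
apply: (@lt_le_trans _ _ (lebesgue_rV R N (cube x e))).
  by rewrite lebesgue_rV_cube// lte_fin exprn_gt0// pmulrn_lgt0.
apply: le_measure; rewrite ?inE//; first exact: measurable_cube.
exact: open_rV_measurable.
Qed.

Lemma measurable_rV_shift N (z : 'rV[R]_N) :
  measurable_fun setT (fun x : 'rV[R]_N => x + z).
Proof.
apply: measurable_fun_coordP => i; under eq_fun do rewrite mxE.
by apply: measurable_funD => //; exact: measurable_coord.
Qed.

(** The translated measure still gives half-open intervals their length, which characterises
    Lebesgue measure. *)
Lemma lebesgue_measure_shift (z : R) (A : set R) : measurable A ->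
  lebesgue_measure ((fun x => x + z) @^-1` A) = lebesgue_measure A.
Proof.
move=> mA; apply/esym.
have ms : measurable_fun setT (fun x : measurableTypeR R => x + z : measurableTypeR R).
  exact: measurable_funD.
rewrite -[RHS]/(pushforward lebesgue_measure
  ((fun x : measurableTypeR R => x + z) : _ -> measurableTypeR R) A).
apply: lebesgue_measure_unique => // _ [[a b]] _ <-.
rewrite /= /pushforward.
rewrite (_ : _ @^-1` _ = `]a - z, b - z]%classic); last first.
  by apply/seteqP; split => x /=; rewrite !in_itv/= ltrBlDr lerBrDr.
rewrite !lebesgue_measure_itv/= !lte_fin ltrD2r; case: ifPn => // _.
by rewrite -!EFinD; congr EFin; ring.
Qed.

(** Induction on N: in the coordinates of [rV_cons] a translation is a product of translations, and
    the product measure is determined by its values on rectangles. *)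
Lemma lebesgue_rV_shift N (z : 'rV[R]_N) (A : set 'rV[R]_N) : measurable A ->
  lebesgue_rV R N ((fun x => x + z) @^-1` A) = lebesgue_rV R N A.
Proof.
elim: N z A => [|N IH] z A mA.
  congr (_ _); apply/seteqP; split => x /=; rewrite (_ : x + z = x)//; apply/rowP => -[]//.
rewrite /= /lebesgue_rV_succ /pushforward.
pose s (p : measurableTypeR R * 'rV[R]_N) : measurableTypeR R * 'rV[R]_N :=
  (p.1 + z ord0 ord0 , p.2 + rsubmx (z : 'rV[R]_(1 + N))).
have ms : measurable_fun setT s.
  apply/measurable_fun_pairP; split => /=.
    by apply: measurable_funD => //; exact: measurable_fst.
  exact: measurableT_comp (measurable_rV_shift _) (@measurable_snd _ _ _ _).
have -> : rV_cons (N:=N) @^-1` ((fun x => x + z) @^-1` A) = s @^-1` (rV_cons (N:=N) @^-1` A).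
  rewrite -2!comp_preimage; congr (_ @^-1` A); apply/funext => -[x y] /=.
  apply/rowP => i; case: (split_ordP (i : 'I_(1 + N))) => j ->.
    have -> : lshift N j = ord0 by apply/val_inj; rewrite /= ord1.
    by rewrite mxE !rV_cons_ord0.
  by rewrite mxE !rV_cons_rshift !mxE.
rewrite -[LHS]/(pushforward _ s _); apply/esym.
apply: product_measure_unique.
  move=> B C mB mC; rewrite /= /pushforward.
  rewrite (_ : _ @^-1` _ = (fun x => x + z ord0 ord0) @^-1` B `*`
    (fun x => x + rsubmx (z : 'rV[R]_(1 + N))) @^-1` C); last first.
    by apply/seteqP; split.
  rewrite product_measure1E.
  + by rewrite IH//; congr (_ * _)%E; exact: lebesgue_measure_shift.
  + by rewrite -[X in measurable X]setTI; apply: measurable_funD.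
  + by rewrite -[X in measurable X]setTI; apply: measurable_rV_shift.
by rewrite -[X in measurable X]setTI; exact: measurable_rV_cons.
Qed.

Lemma ge0_integral_rV_shift N (z : 'rV[R]_N) (D : set 'rV[R]_N) (f : 'rV[R]_N -> \bar R) :
  measurable D -> measurable_fun D f -> (forall x, D x -> (0 <= f x)%E) ->
  (\int[lebesgue_rV R N]_(x in (fun x => (x + z)%R) @^-1` D) f (x + z)%R =
   \int[lebesgue_rV R N]_(x in D) f x)%E.
Proof.
move=> mD mf f0.
rewrite -(@ge0_integral_pushforward _ _ _ _ _ _ (measurable_rV_shift z)
  (lebesgue_rV R N) D f)//; last by move=> y; rewrite inE; exact: f0.
apply: eq_measure_integral => /=; first exact: measurable_rV_shift.
by move=> ? A mA _; exact: lebesgue_rV_shift.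
Qed.

Lemma integral_rV_shift N (z : 'rV[R]_N) (D : set 'rV[R]_N) (f : 'rV[R]_N -> R) :
  measurable D -> measurable_fun D f ->
  \int[lebesgue_rV R N]_(x in (fun x => x + z) @^-1` D) f (x + z) =
   \int[lebesgue_rV R N]_(x in D) f x.
Proof.
move=> mD mf; rewrite /Rintegral; congr fine.
rewrite integralE [in RHS]integralE; congr (_ - _)%E.
  rewrite -(ge0_integral_rV_shift z mD); first by apply: eq_integral => x _; rewrite !funeposE.
  - exact/measurable_funepos/measurable_EFinP.
  - by [].
rewrite -(ge0_integral_rV_shift z mD); first by apply: eq_integral => x _; rewrite !funenegE.
- exact/measurable_funeneg/measurable_EFinP.
- by [].
Qed.

End rV_lebesgue.

(** * Smooth functions with compact support *)

Section flat.
Context (R : realType).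
Implicit Types (P : {poly R}) (x y : R).

(* The derivatives of [x |-> exp (- 1 / x)], extended by 0 to [x <= 0], all have
   this shape. *)
Definition flat P x : R := if 0 < x then P.[x^-1] * expR (- x^-1) else 0.

(** With y = 1 / x, each monomial y^i is at most i! exp y, by the i-th term of the exponential
    series; the sum over the coefficients of P is then absorbed by exp (- y). *)
Lemma flat_bounded P : exists C, 0 <= C /\ forall x, `|flat P x| <= C.
Proof.
have exp_ge y (n : nat) : 0 <= y -> y ^+ n <= n`!%:R * expR y.
  move=> y0; case: n => [|n]; first by rewrite expr0 fact0 mul1r -expR0 ler_expR.
  rewrite -ler_pdivrMl ?ltr0n ?fact_gt0// mulrC (le_trans _ (expR_ge1Dxn n y0))//.
  by rewrite lerDr.
exists (\sum_(i < size P) `|P`_i| * i`!%:R); split.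
  by apply: sumr_ge0 => i _; rewrite mulr_ge0.
move=> x; rewrite /flat; case: ifPn => [x0|_]; last first.
  by rewrite normr0; apply: sumr_ge0 => i _; rewrite mulr_ge0.
rewrite horner_coef normrM (ger0_norm (expR_ge0 _)) expRN.
rewrite ler_pdivrMr ?expR_gt0// (le_trans (ler_norm_sum _ _ _))// mulr_suml.
apply: ler_sum => i _; rewrite normrM -mulrA ler_wpM2l//.
have x0' : 0 <= x^-1 by rewrite invr_ge0 ltW.
by rewrite ger0_norm ?exprn_ge0// exp_ge.
Qed.

Lemma flat_ge0 x : 0 <= flat 1 x.
Proof. by rewrite /flat; case: ifPn => // _; rewrite hornerC mul1r expR_ge0. Qed.

Lemma flat_le1 x : flat 1 x <= 1.
Proof.
rewrite /flat; case: ifPn => // x0; rewrite hornerC mul1r -expR0 ler_expR.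
by rewrite oppr_le0 invr_ge0 ltW.
Qed.

Lemma flat_gt0 x : (0 < flat 1 x) = (0 < x).
Proof.
by rewrite /flat; case: ifPn => x0; rewrite ?ltxx// hornerC mul1r expR_gt0.
Qed.

Let horner_X2 P y : ('X^2 * P).[y] = y ^+ 2 * P.[y].
Proof. by rewrite hornerM hornerXn. Qed.

(** For x > 0 this is the chain rule, the factor X^2 coming from the derivative - 1 / x^2 of 1 / x.
    Only x = 0 needs an estimate. *)
Lemma is_derive_flat P x : is_derive x 1 (flat P) (flat ('X^2 * (P - P^`())) x).
Proof.
have [x0|x0|->] := ltgtP x 0.
- rewrite {2}/flat ltNge (ltW x0)/=.
  have d0 : is_derive x 1 (cst 0 : R -> R) (0 : R) by exact: is_derive_cst.
  apply: near_eq_is_derive d0; near=> y; rewrite /flat ltNge ltW//=.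
  by near: y; exact: lt_nbhsl.
- rewrite /flat x0.
  have dV : is_derive x 1 (fun y : R => y^-1) (- x ^- 2).
    have := @is_deriveV _ id x 1 1 (lt0r_neq0 x0) (is_derive_id _ _).
    by rewrite /= scaler1.
  have d1 : is_derive x 1 (horner P \o (fun y : R => y^-1)) (P^`().[x^-1] * - x ^- 2).
    by apply: is_derive1_comp.
  have d2 : is_derive x 1 (expR \o (fun y : R => - y^-1)) (expR (- x^-1) * - - x ^- 2).
    by apply: is_derive1_comp; exact: is_deriveN.
  have d3 : is_derive x 1 (fun x => P.[x^-1] * expR (- x^-1))
      (('X^2 * (P - P^`())).[x^-1] * expR (- x^-1)).
    apply: (is_derive_eq (is_deriveM d1 d2)).
    by rewrite /= !hornerE -exprVn /GRing.scale/=; ring.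
  apply: near_eq_is_derive d3; near=> y; rewrite /flat ifT//.
  by near: y; exact: lt_nbhsr.
- rewrite [X in is_derive _ _ _ X](_ : _ = 0); last by rewrite /flat ltxx.
  have [C [C0 HC]] := flat_bounded ('X^2 * P).
  have lim0 : h^-1 *: (flat P (h *: 1 + 0) - flat P 0) @[h --> 0^'] --> (0 : R).
    apply/cvgrPdist_lt => e e0; near=> h.
    have h0 : h != 0 by near: h; exact: nbhs_dnbhs_neq.
    rewrite sub0r normrN addr0 [flat P 0]/flat ltxx subr0 /GRing.scale/= mulr1.
    (* The difference quotient at 0 is h times another function of the same family, and these are
       bounded. *)
    rewrite (_ : _ * _ = h * flat ('X^2 * P) h).
      rewrite normrM (@le_lt_trans _ _ (`|h| * (C + 1)))//.
        by rewrite ler_wpM2l// (le_trans (HC h))// lerDl.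
      rewrite -ltr_pdivlMr ?ltr_pwDr//.
      by near: h; apply: dnbhs0_lt; rewrite divr_gt0// ltr_pwDr.
    rewrite /flat; case: ifPn => _; last by rewrite !mulr0.
    by rewrite horner_X2; field.
  by apply: DeriveDef; [apply/cvg_ex; exists 0|exact/cvg_lim].
Unshelve. all: by end_near. Qed.
End flat.

(** * An algebra of smooth functions on R^N *)

Section test_functions.
Context (R : realType) (N : nat).
Implicit Types (f g : 'rV[R]_N -> R) (x y z : 'rV[R]_N) (i : 'I_N).

(* Closed under partial derivatives, and rich enough to approximate indicator
   functions of open sets. *)
Inductive flat_alg : ('rV[R]_N -> R) -> Prop :=
| flat_alg_cst c : flat_alg (fun=> c)
| flat_alg_coord P i (r s : R) : flat_alg (fun x => flat P (r + s * x ord0 i))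
| flat_algD f g : flat_alg f -> flat_alg g -> flat_alg (fun x => f x + g x)
| flat_algM f g : flat_alg f -> flat_alg g -> flat_alg (fun x => f x * g x).

Let is_diff_affine i (r s : R) x :
  is_diff x (fun x => r + s * x ord0 i) (fun v : 'rV[R]_N => s * v ord0 i).
Proof.
pose l : 'rV[R]_N -> R := fun x => s * x ord0 i.
have ll : linear l.
  by move=> a u v; rewrite /l !mxE mulrDr /GRing.scale/= mulrCA.
pose L : {linear 'rV[R]_N -> R} := HB.pack l (GRing.isLinear.Build _ _ _ _ l ll).
have cL : continuous L.
  move=> y; apply: (@cvgM _ _ (nbhs y) _ (fun=> s) (fun x : 'rV[R]_N => x ord0 i)).
    exact: cvg_cst.
  exact: coord_continuous.
have dL : is_diff x L L by apply: DiffDef; [exact: linear_differentiable|exact: diff_lin].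
by have := is_diffD (is_diff_cst r x) dL; rewrite add0r.
Qed.

Let is_diff_flat P (t : R) :
  is_diff t (flat P) (fun u => u * flat ('X^2 * (P - P^`())) t).
Proof.
have [d <-] := is_derive_flat P t.
have dP : differentiable (flat P) t by apply/derivable1_diffP.
apply: DiffDef; first exact: dP.
by rewrite (deriv1E d) derive1E.
Qed.

(** Total differentiability, and not just existence of the partial derivatives, is what turns the
    derivative along an arbitrary z into a combination of partials in [flat_alg_derive]. *)
Lemma flat_alg_differentiable f x : flat_alg f -> differentiable f x.
Proof.
elim=> {f}.
- by move=> c; exact: differentiable_cst.
- move=> P i r s; apply: (@differentiable_comp _ _ _ _ (fun x => r + s * x ord0 i) (flat P)).
    by have [] := is_diff_affine i r s x.
  by have [] := is_diff_flat P (r + s * x ord0 i).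
- by move=> f g _ df _ dg; exact: differentiableD.
- by move=> f g _ df _ dg; exact: differentiableM.
Qed.

Lemma flat_alg_continuous f : flat_alg f -> continuous f.
Proof. by move=> Sf x; apply: differentiable_continuous; exact: flat_alg_differentiable. Qed.

Lemma flat_alg_measurable f D : flat_alg f -> measurable_fun D f.
Proof.
move=> Sf; apply: measurable_funTS; apply: continuous_rV_measurable.
exact: flat_alg_continuous.
Qed.

Lemma flat_alg_partial i f : flat_alg f -> flat_alg (partial i f).
Proof.
elim=> {f}.
- move=> c; rewrite (_ : partial _ _ = fun=> 0); first exact: flat_alg_cst.
  by apply/funext => x; exact: derive_cst.
- move=> P j r s; rewrite (_ : partial _ _ = fun x => s * (i == j)%:R *
     flat ('X^2 * (P - P^`())) (r + s * x ord0 j)).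
    by apply: flat_algM; [exact: flat_alg_cst|exact: flat_alg_coord].
  apply/funext => x; rewrite /partial deriveE; last first.
    exact/flat_alg_differentiable/flat_alg_coord.
  have := is_diff_comp (is_diff_affine j r s x) (is_diff_flat P (r + s * x ord0 j)).
  by move=> /@diff_val ->/=; rewrite mxE eqxx eq_sym.
- move=> f g Sf Sdf Sg Sdg; rewrite (_ : partial _ _ = fun x => partial i f x + partial i g x).
    exact: flat_algD.
  by apply/funext => x; apply: deriveD; exact/diff_derivable/flat_alg_differentiable.
- move=> f g Sf Sdf Sg Sdg; rewrite (_ : partial _ _ = fun x =>
    f x * partial i g x + g x * partial i f x).
    by apply: flat_algD; exact: flat_algM.
  by apply/funext => x; apply: deriveM; exact/diff_derivable/flat_alg_differentiable.
Qed.

Lemma flat_alg_smooth f : flat_alg f -> smooth f.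
Proof.
move=> Sf k; elim: k f Sf => [|k IH] f Sf /=; split=> //; try exact: flat_alg_continuous.
move=> i; split; last exact/IH/flat_alg_partial.
by move=> x; exact/diff_derivable/flat_alg_differentiable.
Qed.

Lemma flat_alg_bounded f : flat_alg f -> exists C, 0 <= C /\ forall x, `|f x| <= C.
Proof.
elim=> {f}.
- by move=> c; exists `|c|.
- by move=> P i r s; have [C [C0 HC]] := flat_bounded P; exists C.
- move=> f g _ [C [C0 HC]] _ [C' [C'0 HC']]; exists (C + C'); split; first exact: addr_ge0.
  by move=> x; rewrite (le_trans (ler_normD _ _))// lerD.
- move=> f g _ [C [C0 HC]] _ [C' [C'0 HC']]; exists (C * C'); split; first exact: mulr_ge0.
  by move=> x; rewrite normrM ler_pM.
Qed.

Lemma flat_alg_shift f z : flat_alg f -> flat_alg (fun x => f (x + z)).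
Proof.
elim=> {f}.
- by move=> c; exact: flat_alg_cst.
- move=> P i r s; rewrite (_ : (fun x => _) =
      fun x => flat P ((r + s * z ord0 i) + s * x ord0 i)); first exact: flat_alg_coord.
  by apply/funext => x; rewrite mxE; congr flat; ring.
- by move=> f g _ Sf _ Sg; exact: flat_algD.
- by move=> f g _ Sf _ Sg; exact: flat_algM.
Qed.

Lemma flat_alg_prod (I : Type) (s : seq I) (F : I -> 'rV[R]_N -> R) :
  (forall k, flat_alg (F k)) -> flat_alg (fun x => \prod_(k <- s) F k x).
Proof.
move=> SF; elim: s => [|k s IH].
  by under eq_fun do rewrite big_nil; exact: flat_alg_cst.
by under eq_fun do rewrite big_cons; exact: flat_algM.
Qed.

Lemma flat_algX f n : flat_alg f -> flat_alg (fun x => f x ^+ n).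
Proof.
move=> Sf; elim: n => [|n IH]; first exact: flat_alg_cst.
by under eq_fun do rewrite exprS; exact: flat_algM.
Qed.

Lemma flat_alg1B f : flat_alg f -> flat_alg (fun x => 1 - f x).
Proof.
move=> Sf; under eq_fun do rewrite -mulN1r.
by apply: flat_algD; [|apply: flat_algM => //]; exact: flat_alg_cst.
Qed.

Lemma flat_alg_derive f x z : flat_alg f ->
  'D_z f x = \sum_i z ord0 i * partial i f x.
Proof.
move=> Sf; have df := flat_alg_differentiable x Sf.
rewrite deriveE// {1}(row_sum_delta z) linear_sum/=; apply: eq_bigr => i _.
by rewrite linearZ/= /partial deriveE.
Qed.

Lemma partial_shift i f z x :
  partial i (fun y => f (y + z)) x = partial i f (x + z).
Proof.
rewrite /partial /derive.
set F := (F in lim (F @ _)); set G := (F in _ = lim (F @ _)).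
by have -> : F = G by apply/funext => h; rewrite /F /G /= -addrA.
Qed.

(** Derivative of a translated test function with respect to the translation parameter; the sign
    comes from moving along - z. *)
Lemma is_derive_line f y z (t : R) : flat_alg f ->
  is_derive t 1 (fun t => f (y - t *: z)) (- \sum_i z ord0 i * partial i f (y - t *: z)).
Proof.
move=> Sf.
have E : (fun h : R => h^-1 *: ((fun t => f (y - t *: z)) (h *: 1 + t) - f (y - t *: z))) =
  (fun h : R => h^-1 *: (f (h *: (- z) + (y - t *: z)) - f (y - t *: z))).
  apply/funext => h; congr (_ *: (f _ - _)).
  by rewrite (_ : h%:A = h) ?scalerDl ?scalerN ?opprD 1?addrCA// [LHS]mulr1.
have dz : derivable f (y - t *: z) (- z).
  exact/diff_derivable/flat_alg_differentiable.
apply: DeriveDef; first by rewrite /derivable E.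
rewrite /derive E -[LHS]/('D_(- z) f (y - t *: z)) flat_alg_derive//.
by rewrite -sumrN; apply: eq_bigr => i _; rewrite mxE mulNr.
Qed.

End test_functions.

(** * Square-integrable functions *)

Section square_integrable_theory.
Context d (T : measurableType d) (R : realType).
Context (mu : {measure set T -> \bar R}) (D : set T) (mD : measurable D).
Implicit Types f g h : T -> R.

Local Notation sqi := (square_integrable mu D).

Lemma integrableM_sqi f g : sqi f -> sqi g ->
  mu.-integrable D (EFin \o (fun x => f x * g x)).
Proof.
move=> [mf f2] [mg g2].
apply: (@le_integrable _ _ _ mu D mD _ (fun x => (f x ^+ 2)%:E + (g x ^+ 2)%:E)%E).
- by apply/measurable_EFinP; exact: measurable_funM.
- move=> x Dx; rewrite -EFinD/= lee_fin normrM [leRHS]ger0_norm ?addr_ge0 ?sqr_ge0//.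
  rewrite -(real_normK (num_real (f x))) -(real_normK (num_real (g x))).
  have := sqr_ge0 (`|f x| - `|g x|); nra.
- apply: integrableD => //; apply/integrableP; split.
  + by apply/measurable_EFinP; exact: measurable_funX.
  + apply: le_lt_trans f2; apply: ge0_le_integral => //.
    * by apply/measurable_EFinP/measurableT_comp => //; exact: measurable_funX.
    * by apply/measurable_EFinP; exact: measurable_funX.
    * by move=> x _; rewrite /= ger0_norm ?sqr_ge0.
  + by apply/measurable_EFinP; exact: measurable_funX.
  + apply: le_lt_trans g2; apply: ge0_le_integral => //.
    * by apply/measurable_EFinP/measurableT_comp => //; exact: measurable_funX.
    * by apply/measurable_EFinP; exact: measurable_funX.
    * by move=> x _; rewrite /= ger0_norm ?sqr_ge0.
Qed.

Lemma integrable_sqi f : sqi f -> mu.-integrable D (EFin \o (fun x => f x ^+ 2)).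
Proof. by move=> sf; under eq_fun do rewrite expr2; exact: integrableM_sqi. Qed.

Lemma sqi_integrable f : measurable_fun D f ->
  mu.-integrable D (EFin \o (fun x => f x ^+ 2)) -> sqi f.
Proof. by move=> mf /integrable_lty fi; split => //; exact: fi. Qed.

Lemma sqiZ (a : R) f : sqi f -> sqi (fun x => a * f x).
Proof.
move=> sf; apply: sqi_integrable; first by apply: measurable_funM => //; case: sf.
under eq_fun do rewrite exprMn.
exact: (integrableZl mD _ (integrable_sqi sf)).
Qed.

Lemma sqiD f g : sqi f -> sqi g -> sqi (fun x => f x + g x).
Proof.
move=> sf sg; apply: sqi_integrable.
  by apply: measurable_funD => //; [case: sf|case: sg].
have h := integrableD mD (integrableD mD (integrable_sqi sf)
  (integrableZl mD 2 (integrableM_sqi sf sg))) (integrable_sqi sg).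
apply: eq_integrable h => // x _ /=.
by rewrite -!EFinM -!EFinD; congr EFin; ring.
Qed.

Lemma sqiB f g : sqi f -> sqi g -> sqi (fun x => f x - g x).
Proof.
move=> sf sg; under eq_fun do rewrite -mulN1r.
by apply: sqiD => //; exact: sqiZ.
Qed.

Lemma sqi_le f g : measurable_fun D f -> sqi g ->
  (forall x, D x -> `|f x| <= `|g x|) -> sqi f.
Proof.
move=> mf [mg g2] fg; split => //; apply: le_lt_trans g2.
apply: ge0_le_integral => //.
- by move=> x _; rewrite lee_fin sqr_ge0.
- by apply/measurable_EFinP; exact: measurable_funX.
- by apply/measurable_EFinP; exact: measurable_funX.
- move=> x Dx; rewrite lee_fin -(real_normK (num_real (f x))).
  by rewrite -(real_normK (num_real (g x))) ler_pXn2r ?nnegrE ?fg.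
Qed.

Lemma sqi_cst (a : R) : (mu D < +oo)%E -> sqi (fun=> a).
Proof.
move=> muD; split => //; rewrite (integral_cst mu mD) lte_mul_pinfty ?lee_fin ?sqr_ge0//.
Qed.

Lemma sqi_bounded (C : R) f : (mu D < +oo)%E -> measurable_fun D f ->
  (forall x, D x -> `|f x| <= C) -> sqi f.
Proof.
move=> muD mf fC; apply: (sqi_le mf (sqi_cst C muD)) => x Dx.
by rewrite (le_trans (fC _ Dx))// ler_norm.
Qed.

Lemma sqi_integrable1 f : (mu D < +oo)%E -> sqi f -> mu.-integrable D (EFin \o f).
Proof.
move=> muD sf; have := integrableM_sqi sf (sqi_cst 1 muD).
by under eq_fun do rewrite mulr1.
Qed.

Lemma RintegralDM (a b : R) f g : mu.-integrable D (EFin \o f) ->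
  mu.-integrable D (EFin \o g) ->
  \int[mu]_(x in D) (a * f x + b * g x) =
  a * \int[mu]_(x in D) f x + b * \int[mu]_(x in D) g x.
Proof.
move=> fi gi; rewrite RintegralD ?RintegralZl//.
  exact: (integrableZl mD a fi).
exact: (integrableZl mD b gi).
Qed.

Lemma integrableDM (a b : R) f g : mu.-integrable D (EFin \o f) ->
  mu.-integrable D (EFin \o g) ->
  mu.-integrable D (EFin \o (fun x => a * f x + b * g x)).
Proof.
move=> fi gi; have := integrableD mD (integrableZl mD a fi) (integrableZl mD b gi).
by apply: eq_integrable => // x _ /=; rewrite -!EFinM -EFinD.
Qed.

(** Young's inequality: the gap between the integrands is (e f - g)^2 / (2 e). *)
Lemma RintegralM_le (e : R) f g : 0 < e -> sqi f -> sqi g ->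
  \int[mu]_(x in D) (f x * g x) <=
  e / 2 * \int[mu]_(x in D) (f x ^+ 2) + (2 * e)^-1 * \int[mu]_(x in D) (g x ^+ 2).
Proof.
move=> e0 sf sg; rewrite -RintegralDM; [|exact: integrable_sqi..].
apply: le_Rintegral => //; first exact: integrableM_sqi.
- by apply: integrableDM; exact: integrable_sqi.
- move=> x _; rewrite -subr_ge0.
  rewrite (_ : _ - _ = (2 * e)^-1 * (e * f x - g x) ^+ 2); last by field; rewrite gt_eqF.
  by rewrite mulr_ge0 ?sqr_ge0// invr_ge0 mulr_ge0// ltW.
Qed.

Lemma EFin_Rintegral_sqr f : sqi f ->
  (\int[mu]_(x in D) f x ^+ 2)%:E = (\int[mu]_(x in D) (f x ^+ 2)%:E)%E.
Proof.
by move=> sf; rewrite fineK//; exact: (integrable_fin_num mD (integrable_sqi sf)).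
Qed.

Lemma Rintegral_sqrD_le f g : sqi f -> sqi g ->
  \int[mu]_(x in D) (f x + g x) ^+ 2 <=
  2 * \int[mu]_(x in D) f x ^+ 2 + 2 * \int[mu]_(x in D) g x ^+ 2.
Proof.
move=> sf sg; rewrite -RintegralDM; [|exact: integrable_sqi..].
apply: le_Rintegral => //; first exact/integrable_sqi/sqiD.
- by apply: integrableDM; exact: integrable_sqi.
- by move=> x _; have := sqr_ge0 (f x - g x); nra.
Qed.

End square_integrable_theory.

(** * Density of test functions in L2 *)

Section density.
Context (R : realType) (N : nat).
Implicit Types (A V E : set 'rV[R]_N) (f g psi : 'rV[R]_N -> R).
Let leb := lebesgue_rV R N.

(** Any compact set outside which f vanishes is accepted in place of the support: such sets pass to
    sums, products and translates without computing closures. *)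
Definition flat_test A f := flat_alg f /\
  exists K, [/\ compact K, K `<=` A & forall x, ~ K x -> f x = 0].

Lemma flat_test_test_function A B f : A `<=` B -> flat_test A f ->
  test_function B f.
Proof.
move=> AB [Sf [K [cK KA fK]]].
have clK : closure [set x | f x != 0] `<=` K.
  have -> : K = closure K by apply/closure_id; exact: compact_closed.
  apply: closureS => x /= fx; apply: contrapT => nKx.
  by move: fx; rewrite fK ?eqxx.
split; first exact: flat_alg_smooth.
  by apply: subclosed_compact clK => //; exact: closed_closure.
exact: subset_trans clK (subset_trans KA AB).
Qed.

Lemma flat_test0 A : flat_test A (fun=> 0).
Proof. by split; [exact: flat_alg_cst|exists set0; split => //; exact: compact0]. Qed.

Lemma flat_testD A f g : flat_test A f -> flat_test A g ->
  flat_test A (fun x => f x + g x).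
Proof.
move=> [Sf [K [cK KA fK]]] [Sg [L [cL LA gL]]]; split; first exact: flat_algD.
exists (K `|` L); split; [exact: compactU| |].
  by move=> x [/KA|/LA].
by move=> x /not_orP[/fK -> /gL ->]; rewrite addr0.
Qed.

Lemma flat_testMr A f g : flat_test A f -> flat_alg g ->
  flat_test A (fun x => f x * g x).
Proof.
move=> [Sf [K [cK KA fK]]] Sg; split; first exact: flat_algM.
by exists K; split => // x /fK ->; rewrite mul0r.
Qed.

Lemma flat_testZ A (a : R) f : flat_test A f -> flat_test A (fun x => a * f x).
Proof.
move=> tf; under eq_fun do rewrite mulrC; apply: flat_testMr => //.
exact: flat_alg_cst.
Qed.

Lemma flat_testS A B f : A `<=` B -> flat_test A f -> flat_test B f.
Proof.
by move=> AB [Sf [K [cK KA fK]]]; split => //; exists K; split => // x /KA/AB.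
Qed.

Lemma flat_test_sqi A f : measurable A -> (leb A < +oo)%E -> flat_test A f ->
  square_integrable leb A f.
Proof.
move=> mA finA [Sf _]; have [C [_ HC]] := flat_alg_bounded Sf.
apply: (sqi_bounded mA (C := C)) => //; exact: flat_alg_measurable.
Qed.

(** Smooth, and positive exactly on the open cube. The coefficients -1 and 1 give each factor
    literally the shape of [flat_alg_coord]. *)
Definition bump (a : 'rV[R]_N) (r : R) (x : 'rV[R]_N) : R :=
  \prod_i (flat 1 (r + a ord0 i + -1 * x ord0 i) *
           flat 1 (r - a ord0 i + 1 * x ord0 i)).

Lemma bump_flat_alg a r : flat_alg (bump a r).
Proof. by apply: flat_alg_prod => i; apply: flat_algM; exact: flat_alg_coord. Qed.

Lemma bump_ge0 a r x : 0 <= bump a r x.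
Proof. by apply: prodr_ge0 => i _; rewrite mulr_ge0 ?flat_ge0. Qed.

Lemma bump_le1 a r x : bump a r x <= 1.
Proof. by apply: prodr_ile1 => i _; rewrite mulr_ge0 ?mulr_ile1 ?flat_ge0 ?flat_le1. Qed.

Lemma bump_gt0 a r x : cube a r x -> 0 < bump a r x.
Proof.
move=> xar; apply: prodr_gt0 => i _; have := xar i; rewrite ltr_norml => /andP[h1 h2].
by rewrite mulr_gt0// flat_gt0; move: h1 h2; lra.
Qed.

Lemma bump_eq0 a r x : ~ cube a r x -> bump a r x = 0.
Proof.
move=> /existsNP[i]; rewrite ltr_norml => /negP; rewrite negb_and => h.
rewrite /bump (bigD1 i)//= [X in X * _](_ : _ = 0) ?mul0r//.
have e0 t : ~~ (0 < t) -> flat 1 t = 0 :> R by rewrite /flat => /negbTE ->.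
case/orP: h => h; [rewrite [X in _ * X]e0 ?mulr0//|rewrite [X in X * _]e0 ?mul0r//].
- by move: h; rewrite -!leNgt; lra.
- by move: h; rewrite -!leNgt; lra.
Qed.

Lemma closed_cube_compact (a : 'rV[R]_N) r : compact (closed_cube a r).
Proof.
rewrite (_ : closed_cube a r = [set v : 'rV[R]_N | forall i,
    `[a ord0 i - r, a ord0 i + r]%classic (v ord0 i)]).
  apply: (@rV_compact R N (fun i => `[a ord0 i - r, a ord0 i + r]%classic)) => i.
  exact: segment_compact.
apply/seteqP; split => x /= h i; have := h i; rewrite in_itv/= ler_norml.
  by move=> /andP[? ?]; apply/andP; split; lra.
by move=> /andP[? ?]; apply/andP; split; lra.
Qed.

(** Exhaust A by countably many cubes and take 1 minus the product over j < n of (1 - bump_j)^n.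
    Finitely many factors keep the support in a finite union of closed cubes; the exponent n drives
    the product to 0 at any point of a cube already included. *)
Lemma open_flat_test_approx A : open A -> exists psi : nat -> 'rV[R]_N -> R,
  [/\ forall n, flat_test A (psi n), forall n x, 0 <= psi n x <= 1 &
      forall x, psi n x @[n --> \oo] --> (\1_A x : R)].
Proof.
move=> oA; have [A0|/set0P A0] := eqVneq A set0.
  exists (fun _ _ => 0); split => [_|n x|x]; first exact: flat_test0.
    by rewrite lexx ler01.
  by rewrite A0 indic0; exact: cvg_cst.
have [a [r [r0 arA AE]]] := open_cube_cover oA A0.
pose p n x := \prod_(j < n) (1 - bump (a j) (r j) x) ^+ n.
have b01 j x : 0 <= 1 - bump (a j) (r j) x <= 1.
  by rewrite subr_ge0 bump_le1 gerBl bump_ge0.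
have p01 n x : 0 <= p n x <= 1.
  apply/andP; split.
    by apply: prodr_ge0 => j _; rewrite exprn_ge0//; have /andP[] := b01 j x.
  apply: prodr_ile1 => j _; have /andP[? ?] := b01 j x.
  by rewrite exprn_ge0//= exprn_ile1.
have bA j x : ~ A x -> bump (a j) (r j) x = 0.
  by move=> nAx; apply: bump_eq0 => xar; apply: nAx; rewrite AE; exists j.
exists (fun n x => 1 - p n x); split.
- move=> n; split.
    apply: flat_alg1B; apply: flat_alg_prod => j; apply: flat_algX.
    by apply: flat_alg1B; exact: bump_flat_alg.
  exists (\big[setU/set0]_(j < n) closed_cube (a j) (r j)); split.
  + by apply: bigsetU_compact => j _; exact: closed_cube_compact.
  + by rewrite -(bigcup_mkord n (fun j => closed_cube (a j) (r j))) => x [j _]; exact: arA.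
  + move=> x nx; rewrite /p big1 ?subrr// => j _.
    rewrite bump_eq0 ?subr0 ?expr1n// => xar; apply: nx.
    by rewrite -(bigcup_mkord n (fun j => closed_cube (a j) (r j))); exists j => //= i; exact/ltW/xar.
- by move=> n x; have /andP[? ?] := p01 n x; rewrite subr_ge0 gerBl; apply/andP.
- move=> x; rewrite indicE; have [Ax|nAx] := pselect (A x); last first.
    rewrite memNset// (_ : (fun n => _) = fun=> 0); first exact: cvg_cst.
    apply/funext => n; rewrite /p big1 ?subrr// => j _.
    by rewrite bA// subr0 expr1n.
  rewrite mem_set//= -[X in _ --> X]subr0; apply: cvgB; first exact: cvg_cst.
  move: (Ax); rewrite {1}AE => -[j _ xj].
  have q1 : `|1 - bump (a j) (r j) x| < 1.
    by rewrite ger0_norm ?ltrBlDr ?ltrDl ?bump_gt0//; have /andP[] := b01 j x.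
  apply: (@squeeze_cvgr _ _ _ _ (fun=> 0) (fun n => (1 - bump (a j) (r j) x) ^+ n)).
  + near=> n; have /andP[-> _] /= := p01 n x.
    have jn : (j < n)%N by near: n; exact: nbhs_infty_gt.
    rewrite /p (bigD1 (Ordinal jn))//= ler_piMr//.
      by rewrite exprn_ge0//; have /andP[] := b01 j x.
    apply: prodr_ile1 => k _; have /andP[? ?] := b01 k x.
    by rewrite exprn_ge0//= exprn_ile1.
  + exact: cvg_cst.
  + exact: cvg_expr.
Unshelve. all: by end_near. Qed.

End density.

Section dominated_sqi.
Context d (T : measurableType d) (R : realType).
Context (mu : {measure set T -> \bar R}) (D : set T) (mD : measurable D).

Lemma dominated_cvg_Rintegral (f_ : nat -> T -> R) (f G : T -> R) :
  (forall n, measurable_fun D (f_ n)) -> measurable_fun D f ->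
  mu.-integrable D (EFin \o G) ->
  (forall x, D x -> f_ n x @[n --> \oo] --> f x) ->
  (forall n x, D x -> `|f_ n x| <= G x) ->
  \int[mu]_(x in D) f_ n x @[n --> \oo] --> \int[mu]_(x in D) f x.
Proof.
move=> mf_ mf iG f_f f_G.
have [||||fi _ cf] := @dominated_convergence _ _ _ mu D mD
  (fun n => EFin \o f_ n) (EFin \o f) (EFin \o G) _ _ _ iG.
- by move=> n; exact/measurable_EFinP.
- exact/measurable_EFinP.
- by apply: aeW => x Dx; apply/cvg_EFin; [exact: nearW|exact: f_f].
- by apply: aeW => x n Dx; rewrite lee_fin; exact: f_G.
apply: fine_cvg; rewrite fineK//; exact: (integrable_fin_num mD fi).
Qed.

Lemma sqi_dominated_cvg (f_ : nat -> T -> R) (f G : T -> R) :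
  (forall n, measurable_fun D (f_ n)) -> measurable_fun D f ->
  square_integrable mu D G ->
  (forall x, D x -> f_ n x @[n --> \oo] --> f x) ->
  (forall n x, D x -> `|f_ n x| <= G x) ->
  square_integrable mu D f /\
  \int[mu]_(x in D) (f x - f_ n x) ^+ 2 @[n --> \oo] --> 0.
Proof.
move=> mf_ mf sG f_f f_G.
have fG x : D x -> `|f x| <= G x.
  move=> Dx; have h : `|f_ n x| @[n --> \oo] --> `|f x| by apply: cvg_norm; exact: f_f.
  rewrite -(cvg_lim _ h)//; apply: limr_le; first by apply/cvg_ex; exists `|f x|.
  by apply: nearW => n; exact: f_G.
split.
  by apply: (sqi_le mD mf sG) => x Dx; rewrite (le_trans (fG _ Dx))// ler_norm.
rewrite (_ : 0 = \int[mu]_(x in D) 0); last first.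
  by rewrite (Rintegral_cst mu mD) mul0r.
apply: (dominated_cvg_Rintegral (G := fun x => 4 * G x ^+ 2)).
- by move=> n; apply: measurable_funX; exact: measurable_funB.
- exact: measurable_cst.
- exact: (integrableZl mD 4 (integrable_sqi mD sG)).
- move=> x Dx; rewrite [X in _ --> X](_ : 0 = (f x - f x) ^+ 2); last by rewrite subrr expr0n.
  have h : f x - f_ n x @[n --> \oo] --> f x - f x.
    by apply: cvgB; [exact: cvg_cst|exact: f_f].
  by rewrite expr2; under eq_fun do rewrite expr2; exact: cvgM.
- move=> n x Dx; have /ler_normlP[h1 h2] := fG _ Dx; have /ler_normlP[h3 h4] := f_G n _ Dx.
  by rewrite ger0_norm ?sqr_ge0//; nra.
Qed.

End dominated_sqi.

(** The sigma-algebra is defined through the coordinates, whereas the Dynkin argument below needs a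
    generating family stable under intersection. *)
Lemma measurable_rV_open (R : realType) (N : nat) :
  @measurable _ 'rV[R]_N = <<s [set V : set 'rV[R]_N | open V] >>.
Proof.
apply/seteqP; split; last first.
  apply: smallest_sub; first exact: sigma_algebra_measurable.
  by move=> V; exact: open_rV_measurable.
apply: smallest_sub; first exact: smallest_sigma_algebra.
rewrite -bigcup_seq => B [i _ [C mC <-]] /=; rewrite setTI.
suff {B C mC} sub : @measurable _ (measurableTypeR R) `<=`
    [set C : set R | <<s [set V : set 'rV[R]_N | open V] >>
      ((fun x : 'rV[R]_N => x ord0 i) @^-1` C)] by exact: sub.
rewrite RGenOpens.measurableE; apply: smallest_sub.
  have [s0 sC sU] := smallest_sigma_algebra [set: 'rV[R]_N] [set V : set 'rV[R]_N | open V].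
  split => /=.
  - by rewrite preimage_set0.
  - by move=> B /sC; rewrite !setTD preimage_setC.
  - by move=> F /sU; rewrite preimage_bigcup.
move=> _ [a [b ->]] /=; apply: sub_sigma_algebra => /=.
have /continuousP := @coord_continuous R 1 N ord0 i.
by apply; exact: interval_open.
Qed.

Section flat_test_dense.
Context (R : realType) (N : nat).
Implicit Types (V E : set 'rV[R]_N) (f g h psi : 'rV[R]_N -> R).
Let leb := lebesgue_rV R N.
Context (A : set 'rV[R]_N) (oA : open A) (finA : (leb A < +oo)%E).
Let mA : measurable A := open_rV_measurable oA.
Local Notation sqi := (square_integrable leb A).

(** The L2 closure of the test functions. It is shown to contain, in turn, indicators of open sets,
    indicators of Borel sets, simple functions, nonnegative functions, and all of L2. *)
Let app h := sqi h /\ forall e : R, 0 < e -> exists2 psi, flat_test A psi &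
  \int[leb]_(x in A) (h x - psi x) ^+ 2 < e.

Let app_test psi : flat_test A psi -> app psi.
Proof.
move=> tpsi; split; first exact: flat_test_sqi.
move=> e e0; exists psi => //.
under eq_Rintegral do rewrite subrr expr0n/=.
by rewrite (Rintegral_cst leb mA) mul0r.
Qed.

Let appD f g : app f -> app g -> app (fun x => f x + g x).
Proof.
move=> [sf af] [sg ag]; split; first exact: sqiD.
(* A quarter of e for each term, since [Rintegral_sqrD_le] doubles both. *)
move=> e e0; have e4 : 0 < e / 4 by rewrite divr_gt0.
have [p tp fp] := af _ e4; have [q tq gq] := ag _ e4.
exists (fun x => p x + q x); first exact: flat_testD.
have sp := flat_test_sqi mA finA tp; have sq := flat_test_sqi mA finA tq.
under eq_Rintegral do rewrite opprD addrACA.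
have := Rintegral_sqrD_le mA (sqiB mA sf sp) (sqiB mA sg sq).
by move: fp gq; lra.
Qed.

Let appZ (a : R) f : app f -> app (fun x => a * f x).
Proof.
move=> [sf af]; split; first exact: sqiZ.
(* The added 1 covers a = 0. *)
move=> e e0; have e4 : 0 < e / (a ^+ 2 + 1) by rewrite divr_gt0// ltr_wpDl ?sqr_ge0.
have [p tp fp] := af _ e4.
exists (fun x => a * p x); first exact: flat_testZ.
have sp := flat_test_sqi mA finA tp.
under eq_Rintegral do rewrite -mulrBr exprMn.
rewrite (RintegralZl _ mA (integrable_sqi mA (sqiB mA sf sp)))//.
move: fp; rewrite ltr_pdivlMr ?ltr_wpDl ?sqr_ge0// mulrC.
apply: le_lt_trans; rewrite ler_wpM2r ?lerDl//.
by apply: Rintegral_ge0 => x _; exact: sqr_ge0.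
Qed.

Let app_lim (h_ : nat -> 'rV[R]_N -> R) h G : (forall n, app (h_ n)) ->
  measurable_fun A h -> sqi G ->
  (forall x, A x -> h_ n x @[n --> \oo] --> h x) ->
  (forall n x, A x -> `|h_ n x| <= G x) -> app h.
Proof.
move=> ah mh sG hh hG.
have [|sh ch] := sqi_dominated_cvg mA _ mh sG hh hG.
  by move=> n; case: (ah n) => -[].
split => // e e0; have e4 : 0 < e / 4 by rewrite divr_gt0.
have /cvgrPdist_lt/(_ _ e4)[n _ /(_ n (leqnn n))] := ch.
rewrite sub0r normrN ger0_norm; last by apply: Rintegral_ge0 => x _; exact: sqr_ge0.
move=> hn; have [sn /(_ _ e4)[p tp np]] := ah n.
exists p => //; have sp := flat_test_sqi mA finA tp.
rewrite (_ : Rintegral _ _ _ =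
    \int[leb]_(x in A) ((h x - h_ n x) + (h_ n x - p x)) ^+ 2); last first.
  by apply: eq_Rintegral => x _; rewrite subrKA.
have := Rintegral_sqrD_le mA (sqiB mA sh sn) (sqiB mA sn sp).
by move: hn np; lra.
Qed.

Let app_open V : open V -> app (\1_(A `&` V)).
Proof.
move=> oV; have [psi [tpsi psi01 psiV]] := open_flat_test_approx (openI oA oV).
apply: (@app_lim psi _ (fun=> 1)).
- by move=> n; apply: app_test; exact: flat_testS (tpsi n).
- by apply: measurable_indic; apply: measurableI => //; exact: open_rV_measurable.
- exact: sqi_cst.
- by move=> x _; exact: psiV.
- by move=> n x _; have /andP[? ?] := psi01 n x; rewrite ger0_norm.
Qed.

(** Dynkin induction from the open sets: complements subtract from the indicator of A, and disjoint
    unions are limits of partial sums dominated by 1, which is in L2 because A has finite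
    measure. *)
Let app_measurable E : measurable E -> app (\1_(A `&` E)).
Proof.
rewrite measurable_rV_open; move: E.
apply: (@dynkin_induction _ _ _ (fun E => app \1_(A `&` E)) (@measurable_rV_open R N)).
- by move=> V W; exact: openI.
- by apply: app_open; exact: openT.
- by move=> V; exact: app_open.
- move=> E mE aE; rewrite (_ : \1_(A `&` ~` E) =
      fun x => \1_(A `&` setT) x + -1 * \1_(A `&` E) x).
    apply: appD; last exact: appZ.
    by apply: app_open; exact: openT.
  apply/funext => x; rewrite setIT !indicE !in_setI in_setC.
  by case: (x \in A); case: (x \in E) => /=; rewrite ?mulr0 ?mulr1 ?addr0 ?subrr.
- move=> F mF tF aF.
  pose s n x := \sum_(k < n) (\1_(A `&` F k) x : R).
  have sE k n x : A x -> F k x -> (k < n)%N -> s n x = 1.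
    move=> Ax Fkx kn; rewrite /s (bigD1 (Ordinal kn))//= indicE mem_set// big1 ?addr0// => j jk.
    rewrite indicE memNset// => -[_ Fjx]; move/eqP : jk; apply; apply/val_inj => /=.
    by apply: (tF j k) => //; exists x.
  have s0 n x : (forall k, ~ (A `&` F k) x) -> s n x = 0.
    by move=> nx; rewrite /s big1// => k _; rewrite indicE memNset.
  apply: (@app_lim s _ (fun=> 1)).
  + move=> n; rewrite /s; elim: n => [|n IH].
      by under eq_fun do rewrite big_ord0; apply: app_test; exact: flat_test0.
    by under eq_fun do rewrite big_ord_recr/=; exact: appD.
  + by apply: measurable_indic; apply: measurableI => //; exact: bigcupT_measurable.
  + exact: sqi_cst.
  + move=> x Ax; rewrite indicE; have [[k _ Fkx]|nF] := pselect ((\bigcup_k F k) x).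
      rewrite mem_set/=; last by split => //; exists k.
      apply: cvg_near_cst; near=> n; apply/eqP.
      by rewrite (sE k)//; near: n; exact: nbhs_infty_gt.
    rewrite memNset; last by case.
    rewrite (_ : (fun n => s n x) = fun=> 0); first exact: cvg_cst.
    by apply/funext => n; rewrite s0// => k [_ Fkx]; apply: nF; exists k.
  + move=> n x Ax; have [[k kn Fkx]|no] := pselect (exists2 k, (k < n)%N & F k x).
      by rewrite (sE k)// normr1.
    rewrite /s big1 ?normr0// => k _; rewrite indicE memNset// => -[_ Fkx].
    by apply: no; exists k.
Unshelve. all: by end_near. Qed.

Import HBNNSimple.

Let app_sfun (g : {nnsfun 'rV[R]_N >-> R}) :
  app (fun x => g x * \1_A x).
Proof.
pose s := finmap.enum_fset (fset_set (range g)).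
rewrite (_ : (fun x => _) = fun x => \sum_(i < size s)
    s`_i * \1_(A `&` (g @^-1` [set s`_i])) x).
  move: (size s) => m; elim: m => [|n IH].
    by under eq_fun do rewrite big_ord0; apply: app_test; exact: flat_test0.
  under eq_fun do rewrite big_ord_recr/=; apply: appD => //; apply: appZ.
  exact: app_measurable.
apply/funext => x; rewrite fimfunEord mulr_suml; apply: eq_bigr => i _.
by rewrite indicI/= -mulrA; congr (_ * _); rewrite mulrC.
Qed.

Let app_ge0 h : sqi h -> (forall x, A x -> 0 <= h x) -> app h.
Proof.
move=> sh h0; have mh : measurable_fun A (EFin \o h) by apply/measurable_EFinP; case: sh.
pose g := nnsfun_approx mA mh.
apply: (@app_lim (fun n x => g n x * \1_A x) _ h).
- by move=> n; exact: app_sfun.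
- by case: sh.
- by [].
- move=> x Ax; rewrite indicE mem_set//; under eq_fun do rewrite mulr1.
  have : (EFin \o g^~ x) @ \oo --> (EFin \o h) x.
    by apply: (cvg_nnsfun_approx mA mh) => // y Ay; rewrite lee_fin h0.
  by move=> /fine_cvg.
- move=> n x Ax; rewrite indicE mem_set// mulr1 ger0_norm//.
  by rewrite nnsfun_approxE -lee_fin; exact: le_approx.
Qed.

Lemma flat_test_dense h : sqi h -> forall e : R, 0 < e ->
  exists2 psi, flat_test A psi & \int[leb]_(x in A) (h x - psi x) ^+ 2 < e.
Proof.
move=> sh; have mh : measurable_fun A h by case: sh.
suff [] : app h by [].
rewrite (_ : h = fun x => h^\+ x + -1 * h^\- x); last first.
  by apply/funext => x; rewrite mulN1r -[in LHS](funrposBneg h).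
have hpn x : h^\+ x + h^\- x = `|h x| by have /(congr1 (@^~ x)) := funrposDneg h.
apply: appD; last apply: appZ.
- apply: app_ge0 => [|x _]; last exact: funrpos_ge0.
  apply: (sqi_le mA _ sh) => [|x Ax]; first exact: measurable_funrpos.
  by rewrite ger0_norm ?funrpos_ge0// -hpn lerDl funrneg_ge0.
- apply: app_ge0 => [|x _]; last exact: funrneg_ge0.
  apply: (sqi_le mA _ sh) => [|x Ax]; first exact: measurable_funrneg.
  by rewrite ger0_norm ?funrneg_ge0// -hpn lerDr funrpos_ge0.
Qed.

(** If h itself could be inserted for psi, the hypothesis would read |h|^2 <= M / 2 + |h|^2 / 2,
    which is the claim. A test function psi with |h - psi|^2 < e loses only e, as expanding that
    square shows. *)
Lemma sqi_dual_le h (M : R) : sqi h ->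
  (forall psi, flat_test A psi -> \int[leb]_(x in A) (h x * psi x) <=
     M / 2 + 2^-1 * \int[leb]_(x in A) psi x ^+ 2) ->
  \int[leb]_(x in A) h x ^+ 2 <= M.
Proof.
move=> sh hM; apply/ler_addgt0Pr => e e0.
have [psi tpsi he] := flat_test_dense sh e0.
have sp := flat_test_sqi mA finA tpsi.
have E : \int[leb]_(x in A) (h x - psi x) ^+ 2 = \int[leb]_(x in A) h x ^+ 2
   - 2 * \int[leb]_(x in A) (h x * psi x) + \int[leb]_(x in A) psi x ^+ 2.
  have i1 := integrable_sqi mA sh; have i2 := integrable_sqi mA sp.
  have i3 := integrableM_sqi mA sh sp.
  rewrite -[X in _ - _ + X]mul1r -[X in X - _ + _]mul1r -mulNr.
  rewrite -RintegralDM// -[X in X + _]mul1r -RintegralDM//; last exact: integrableDM.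
  by apply: eq_Rintegral => x _; ring.
by have := hM _ tpsi; move: he; rewrite E; lra.
Qed.

End flat_test_dense.

(** * Differentiation under the integral, and integrals of partial derivatives *)

Section diff_under_integral.
Context d (T : measurableType d) (R : realType).
Context (mu : {measure set T -> \bar R}) (D : set T) (mD : measurable D).

Lemma is_derive_integral (u : T -> R) (phi phi' : R -> T -> R) (C t : R) :
  0 <= C -> mu.-integrable D (EFin \o u) ->
  (forall s, measurable_fun D (phi s)) ->
  (forall s x, `|phi s x| <= C) ->
  (forall (s : R) x, is_derive s 1 (phi^~ x) (phi' s x)) ->
  (forall s x, `|phi' s x| <= C) ->
  is_derive t 1 (fun s => \int[mu]_(x in D) (u x * phi s x))
    (\int[mu]_(x in D) (u x * phi' t x)).
Proof.
move=> C0 iu mphi phiC dphi phi'C.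
have mu_ : measurable_fun D u by have /integrableP[/measurable_EFinP] := iu.
have dp (s : R) x : is_derive s 1 (fun s => u x * phi s x) (u x * phi' s x).
  exact: is_deriveZ.
have pE s x : partial1of2 (fun s y => u y * phi s y) s x = u x * phi' s x.
  by rewrite partial1of2E; exact: (@derive_val _ _ _ _ _ _ _ (dp s x)).
have iG : mu.-integrable D (EFin \o (fun x => C * `|u x|)).
  exact: (integrableZl mD C (integrable_norm iu)).
(* The bounds hold for every s, so any interval around t serves; C |u| dominates. *)
have h := @cvg_differentiation_under_integral R d T mu (fun s y => u y * phi s y)
  D mD t (t - 1) (t + 1) _ _ _ (fun x => C * `|u x|) _ iG _.
have {}h : h^-1 *: (\int[mu]_(y in D) (u y * phi (h + t) y) -
    \int[mu]_(y in D) (u y * phi t y)) @[h --> 0^'] -->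
    \int[mu]_(x in D) (u x * phi' t x).
  under [X in _ --> X]eq_Rintegral do rewrite -pE.
  apply: h.
  - by rewrite /= in_itv/=; lra.
  - move=> s _; apply: (le_integrable mD _ _ iG).
      by apply/measurable_EFinP; exact: measurable_funM.
    move=> x Dx; rewrite /= lee_fin normrM mulrC [leRHS]ger0_norm ?ler_wpM2r//.
    by rewrite mulr_ge0// C0.
  - by move=> s x _ _; exact: ex_derive.
  - by move=> x; rewrite mulr_ge0// C0.
  - by move=> s x _ _; rewrite pE normrM mulrC ler_wpM2r.
have E : (fun h : R => h^-1 *: (\int[mu]_(y in D) (u y * phi (h *: 1 + t) y) -
    \int[mu]_(y in D) (u y * phi t y))) =
  (fun h : R => h^-1 *: (\int[mu]_(y in D) (u y * phi (h + t) y) -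
    \int[mu]_(y in D) (u y * phi t y))).
  by apply/funext => s; rewrite [s *: 1]mulr1.
apply: DeriveDef; first by rewrite /derivable E; apply/cvg_ex; eexists; exact: h.
by rewrite /derive E; exact: cvg_lim h.
Qed.

End diff_under_integral.

Section test_function_theory.
Context (R : realType) (N : nat).
Implicit Types (A B : set 'rV[R]_N) (f g : 'rV[R]_N -> R).
Let leb := lebesgue_rV R N.

Lemma compact_support_bounded (K : set 'rV[R]_N) g : compact K -> continuous g ->
  (forall x, ~ K x -> g x = 0) -> exists C, 0 <= C /\ forall x, `|g x| <= C.
Proof.
move=> cK cg gK.
have [M [_ /(_ (M + 1))]] : bounded_set (g @` K).
  apply: compact_bounded; apply: continuous_compact => //.
  exact: continuous_subspaceT.
rewrite ltrDl ltr01 => /(_ isT) HM.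
exists `|M + 1|; split => // x; have [Kx|nKx] := pselect (K x).
  by rewrite (le_trans _ (ler_norm _))//; apply: HM; exists x.
by rewrite gK// normr0.
Qed.

Lemma test_function_continuous B f : test_function B f -> continuous f.
Proof. by case=> /(_ 0%N) []. Qed.

Lemma test_function_partial B f i : test_function B f -> continuous (partial i f).
Proof. by case=> /(_ 1%N) [_ /(_ i)] [_ []]. Qed.

Lemma test_function_derivable B f i x : test_function B f ->
  derivable f x (delta_mx ord0 i).
Proof. by case=> /(_ 1%N) [_ /(_ i)] []. Qed.

Lemma notin_support_eq0 f x :
  ~ closure [set x | f x != 0] x -> f x = 0.
Proof.
move=> nx; apply/eqP/negPn/negP => fx; apply: nx.
exact: subset_closure.
Qed.

Lemma partial_notin_support f i x :
  ~ closure [set x | f x != 0] x -> partial i f x = 0.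
Proof.
move=> nx; rewrite /partial (@near_eq_derive _ _ _ f (cst 0)) ?derive_cst//.
have : open (~` closure [set x | f x != 0]) by apply: closed_openC; exact: closed_closure.
move=> oC; have := open_nbhs_nbhs (conj oC nx).
by apply: filterS => y; exact: notin_support_eq0.
Qed.

Lemma test_function_bounded B f : test_function B f ->
  exists C, 0 <= C /\ forall x, `|f x| <= C.
Proof.
move=> tf; apply: (compact_support_bounded (K := closure [set x | f x != 0])).
- by case: tf.
- exact: test_function_continuous tf.
- by move=> x; exact: notin_support_eq0.
Qed.

Lemma test_function_partial_bounded B f i : test_function B f ->
  exists C, 0 <= C /\ forall x, `|partial i f x| <= C.
Proof.
move=> tf; apply: (compact_support_bounded (K := closure [set x | f x != 0])).
- by case: tf.
- exact: test_function_partial tf.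
- by move=> x; exact: partial_notin_support.
Qed.

Lemma test_function_sqi A B f : measurable A -> (leb A < +oo)%E -> test_function B f ->
  square_integrable leb A f.
Proof.
move=> mA finA tf; have [C [_ HC]] := test_function_bounded tf.
apply: (sqi_bounded mA (C := C)) => //; apply: measurable_funTS.
exact: (continuous_rV_measurable (test_function_continuous tf)).
Qed.

Lemma test_function_partial_sqi A B f i : measurable A -> (leb A < +oo)%E ->
  test_function B f -> square_integrable leb A (partial i f).
Proof.
move=> mA finA tf; have [C [_ HC]] := test_function_partial_bounded i tf.
apply: (sqi_bounded mA (C := C)) => //; apply: measurable_funTS.
exact: (continuous_rV_measurable (test_function_partial tf)).
Qed.

Lemma Rintegral_support A B g : measurable A -> measurable B ->
  (forall x, A x -> ~ B x -> g x = 0) -> (forall x, B x -> ~ A x -> g x = 0) ->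
  \int[leb]_(x in A) g x = \int[leb]_(x in B) g x.
Proof.
move=> mA mB gA gB; rewrite Rintegral_mkcond [RHS]Rintegral_mkcond.
congr Rintegral; apply/funext => x; rewrite !patchE.
case: ifPn => [|]; case: ifPn => [|]//; rewrite ?inE ?notin_setE.
- by move=> Bx Ax; exact: gA.
- by move=> Bx Ax; rewrite gB.
Qed.

Lemma normr_coord_le (x : 'rV[R]_N) (i : 'I_N) : `|x ord0 i| <= `|x|.
Proof.
rewrite [leRHS]/Num.norm /= mx_normrE.
by apply: (le_trans _ (le_bigmax _ _ (ord0, i))).
Qed.

Lemma test_function_partial_derive B f i x (s : R) : test_function B f ->
  is_derive s 1 (fun s => f (x + s *: delta_mx ord0 i))
    (partial i f (x + s *: delta_mx ord0 i)).
Proof.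
move=> tf; set e := delta_mx _ _; have df := @test_function_derivable _ _ i (x + s *: e) tf.
have E : (fun h : R => h^-1 *: ((fun s => f (x + s *: e)) (h *: 1 + s) - f (x + s *: e))) =
  (fun h : R => h^-1 *: (f (h *: e + (x + s *: e)) - f (x + s *: e))).
  apply/funext => h; congr (_ *: (f _ - _)).
  by rewrite (_ : h%:A = h) ?scalerDl 1?addrCA// [LHS]mulr1.
by apply: DeriveDef; [rewrite /derivable E|rewrite /derive E].
Qed.

(** Integrate f (x + s e_i) over a cube B containing all translates of the support with |s| < 1: the
    result is constant in s, and its derivative at s = 0 is the integral in question. This makes the
    weak gradient of a constant vanish. *)
Lemma Rintegral_partial0 A f i : measurable A -> test_function A f ->
  \int[leb]_(x in A) partial i f x = 0.
Proof.
move=> mA tf.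
have [_ cK KA] := tf; set K := closure _ in cK KA.
have [M [_ /(_ (M + 1))]] := compact_bounded cK.
rewrite ltrDl ltr01 => /(_ isT) HM.
(* The support lies within M + 1 of the origin, and a translation moves it by less than 1. *)
pose r := `|M| + 3; have r0 : 0 < r by rewrite ltr_wpDl.
pose B : set 'rV[R]_N := cube 0 r.
have mB : measurable B by exact: measurable_cube.
have finB : (leb B < +oo)%E by rewrite lebesgue_rV_cube// ltry.
pose e : 'rV[R]_N := delta_mx ord0 i.
have KB (t : R) x : `|t| < 1 -> K (x + t *: e) -> B x.
  move=> t1 /HM xM j; rewrite mxE subr0.
  have := le_trans (normr_coord_le (x + t *: e) j) xM; rewrite !mxE => h.
  have : `|t * ((ord0 == ord0 :> 'I_1) && (j == i))%:R| <= `|t|.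
    by rewrite normrM ler_piMr//; case: (_ && _); rewrite ?normr1 ?normr0.
  move: h; set d := t * _; set y := x ord0 j => h dt.
  rewrite -(addrK d y); apply: (le_lt_trans (ler_normB _ _)).
  rewrite /r; move: h dt t1 (ler_norm M); lra.
(* The factor 1 is the weight u of [is_derive_integral]. *)
pose F (s : R) := \int[leb]_(x in B) (1 * f (x + s *: e)).
have Fcst (s : R) : `|s| < 1 -> F s = F 0.
  suff h (t : R) : `|t| < 1 -> F t = \int[leb]_(x in setT) f x.
    by move=> s1; rewrite !h// normr0.
  move=> t1; rewrite -(@integral_rV_shift _ _ (t *: e) setT f)//; last first.
    exact: (continuous_rV_measurable (test_function_continuous tf)).
  rewrite /F; under eq_Rintegral do rewrite mul1r.
  rewrite preimage_setT; apply: Rintegral_support => // x _ nBx; first by case: nBx.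
  by apply: notin_support_eq0 => Kx; apply: nBx; exact: KB Kx.
have [C [C0 fC]] := test_function_bounded tf.
have [C' [C'0 f'C]] := test_function_partial_bounded i tf.
have dF : is_derive (0 : R) 1 F (\int[leb]_(x in B) (1 * partial i f (x + 0 *: e))).
  apply: (@is_derive_integral _ _ _ leb B mB (fun=> 1) (fun s x => f (x + s *: e))
    (fun s x => partial i f (x + s *: e)) (C + C')).
  - exact: addr_ge0.
  - exact: (sqi_integrable1 mB finB (sqi_cst mB 1 finB)).
  - move=> s; apply: measurable_funTS; apply: measurableT_comp (measurable_rV_shift _).
    exact: (continuous_rV_measurable (test_function_continuous tf)).
  - by move=> s x; rewrite (le_trans (fC _))// lerDl.
  - by move=> s x; exact: test_function_partial_derive tf.
  - by move=> s x; rewrite (le_trans (f'C _))// lerDr.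
have dF0 : is_derive (0 : R) 1 F 0.
  have : is_derive (0 : R) 1 (cst (F 0)) 0 by exact: is_derive_cst.
  apply: near_eq_is_derive; near=> s; apply/esym/Fcst.
  near: s; apply/nbhs_ballP; exists 1 => //= y.
  by rewrite /ball/= sub0r normrN.
have := @derive_val _ _ _ _ _ _ _ dF; rewrite (@derive_val _ _ _ _ _ _ _ dF0) => E0.
rewrite [RHS]E0; under [RHS]eq_Rintegral do rewrite mul1r scale0r addr0.
apply: Rintegral_support => // x _ nx; apply: partial_notin_support => Kx.
- by apply: nx; apply: (KB 0); rewrite ?normr0// scale0r addr0.
- by apply: nx; exact: KA.
Unshelve. all: by end_near. Qed.

End test_function_theory.

Section ae_integrals.
Context d (T : measurableType d) (R : realType).
Context (mu : {measure set T -> \bar R}) (D : set T) (mD : measurable D).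

Lemma sqi_ae0 (f : T -> R) : square_integrable mu D f ->
  \int[mu]_(x in D) f x ^+ 2 <= 0 -> {ae mu, forall x, D x -> f x = 0}.
Proof.
move=> sf; rewrite -lee_fin EFin_Rintegral_sqr// => f0.
pose F x := (f x ^+ 2)%:E.
have mf2 : measurable_fun D F.
  by apply/measurable_EFinP; apply: measurable_funX; case: sf.
have : (\int[mu]_(x in D) `|F x| = 0)%E.
  apply/eqP; rewrite eq_le integral_ge0 ?andbT//.
  apply: le_trans f0; rewrite le_eqVlt; apply/orP; left; apply/eqP.
  by apply: eq_integral => x _; rewrite gee0_abs// lee_fin sqr_ge0.
move=> /(ae_eq_integral_abs mu mD mf2); apply: filterS => x /= + Dx.
by move=> /(_ Dx)/eqP; rewrite eqe sqrf_eq0 => /eqP.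
Qed.

Lemma ae_eq_Rintegral (f g : T -> R) : measurable_fun D f -> measurable_fun D g ->
  {ae mu, forall x, D x -> f x = g x} ->
  \int[mu]_(x in D) f x = \int[mu]_(x in D) g x.
Proof.
move=> mf mg fg; rewrite /Rintegral; congr fine; apply: ae_eq_integral => //.
- exact/measurable_EFinP.
- exact/measurable_EFinP.
- by apply: filterS fg => x + Dx => /(_ Dx) ->.
Qed.

End ae_integrals.

(** * Weak derivatives *)

Section weak_derivatives.
Context (R : realType) (N : nat) (Omega : set 'rV[R]_N).
Let leb := lebesgue_rV R N.
Context (oO : open Omega) (finO : (leb Omega < +oo)%E).
Let mO : measurable Omega := open_rV_measurable oO.
Implicit Types (u v g h : 'rV[R]_N -> R) (i : 'I_N).

(** The difference g - h pairs to 0 with every test function, so [sqi_dual_le] applies with M =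
    0. *)
Lemma is_weak_partial_unique i u g h : L2 Omega g -> L2 Omega h ->
  is_weak_partial Omega i u g -> is_weak_partial Omega i u h ->
  {ae leb, forall x, Omega x -> g x = h x}.
Proof.
move=> sg sh wg wh.
have : \int[leb]_(x in Omega) (g x - h x) ^+ 2 <= 0.
  apply: (sqi_dual_le oO finO (sqiB mO sg sh)) => psi tpsi.
  have sp := flat_test_sqi mO finO tpsi.
  have tp := flat_test_test_function (@subset_refl _ Omega) tpsi.
  have := wh _ tp; rewrite (wg _ tp) => /oppr_inj E.
  rewrite [X in X <= _](_ : _ = 1 * \int[leb]_(x in Omega) (g x * psi x) +
    -1 * \int[leb]_(x in Omega) (h x * psi x)); last first.
    rewrite -RintegralDM//; [|exact: integrableM_sqi..].
    by apply: eq_Rintegral => x _; ring.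
  rewrite E mul1r mulN1r subrr mul0r add0r mulr_ge0//.
  by apply: Rintegral_ge0 => x _; exact: sqr_ge0.
move=> /(sqi_ae0 mO (sqiB mO sg sh)); apply: filterS => x + Ox => /(_ Ox)/eqP.
by rewrite subr_eq0 => /eqP.
Qed.

Lemma weak_partialP i u : H1 Omega u -> L2 Omega (weak_partial Omega i u) /\
  is_weak_partial Omega i u (weak_partial Omega i u).
Proof.
move=> [_ /(_ i)[g [sg wg]]].
exact: (@xgetPex _ (cst 0) [set g | L2 Omega g /\ is_weak_partial Omega i u g] (ex_intro _ g (conj sg wg))).
Qed.

(** [weak_partial] is an arbitrary choice; every computation of it goes through a candidate and
    uniqueness. *)
Lemma weak_partialE i u g : L2 Omega g -> is_weak_partial Omega i u g ->
  {ae leb, forall x, Omega x -> weak_partial Omega i u x = g x}.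
Proof.
move=> sg wg; have [sw ww] := @xgetPex _ (cst 0)
  [set g | L2 Omega g /\ is_weak_partial Omega i u g] (ex_intro _ g (conj sg wg)).
exact: is_weak_partial_unique sw sg ww wg.
Qed.

Lemma is_weak_partial_lin i (a : R) u v g h : L2 Omega u -> L2 Omega v ->
  L2 Omega g -> L2 Omega h ->
  is_weak_partial Omega i u g -> is_weak_partial Omega i v h ->
  is_weak_partial Omega i (fun x => a * u x + v x) (fun x => a * g x + h x).
Proof.
move=> su sv sg sh wg wh f tf.
have sf := test_function_sqi mO finO tf.
have sdf := test_function_partial_sqi i mO finO tf.
rewrite [LHS](_ : _ = a * \int[leb]_(x in Omega) (u x * partial i f x) +
    1 * \int[leb]_(x in Omega) (v x * partial i f x)); last first.
  rewrite -RintegralDM//; [|exact: integrableM_sqi..].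
  by apply: eq_Rintegral => x _; ring.
rewrite (wg _ tf) (wh _ tf) mulrN mulrN -opprD; congr (- _).
rewrite -RintegralDM//; [|exact: integrableM_sqi..].
by apply: eq_Rintegral => x _; ring.
Qed.

Lemma is_weak_partial_cst i (k : R) : is_weak_partial Omega i (fun=> k) (fun=> 0).
Proof.
move=> f tf; have sdf := test_function_partial_sqi i mO finO tf.
rewrite RintegralZl//; last exact: sqi_integrable1.
rewrite (Rintegral_partial0 i mO tf) mulr0.
under eq_Rintegral do rewrite mul0r.
by rewrite (Rintegral_cst leb mO) mul0r oppr0.
Qed.

Lemma H1_lin (a : R) u v : H1 Omega u -> H1 Omega v -> H1 Omega (fun x => a * u x + v x).
Proof.
move=> Hu Hv; split; first exact: (sqiD mO (sqiZ mO a (proj1 Hu)) (proj1 Hv)).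
move=> i; have [sg wg] := weak_partialP i Hu; have [sh wh] := weak_partialP i Hv.
exists (fun x => a * weak_partial Omega i u x + weak_partial Omega i v x); split.
  exact: (sqiD mO (sqiZ mO a sg) sh).
exact: (is_weak_partial_lin a (proj1 Hu) (proj1 Hv) sg sh wg wh).
Qed.

Lemma weak_partial_lin i (a : R) u v : H1 Omega u -> H1 Omega v ->
  {ae leb, forall x, Omega x -> weak_partial Omega i (fun x => a * u x + v x) x =
    a * weak_partial Omega i u x + weak_partial Omega i v x}.
Proof.
move=> Hu Hv.
have [sg wg] := weak_partialP i Hu; have [sh wh] := weak_partialP i Hv.
apply: (weak_partialE (sqiD mO (sqiZ mO a sg) sh)).
exact: (is_weak_partial_lin a (proj1 Hu) (proj1 Hv) sg sh wg wh).
Qed.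

Lemma H1_cst (k : R) : H1 Omega (fun=> k).
Proof.
split; first exact: sqi_cst.
by move=> i; exists (fun=> 0); split; [exact: sqi_cst|exact: is_weak_partial_cst].
Qed.

Lemma weak_partial_addC i u (k : R) : H1 Omega u ->
  {ae leb, forall x, Omega x -> weak_partial Omega i (fun x => u x - k) x =
    weak_partial Omega i u x}.
Proof.
move=> Hu; have [sg wg] := weak_partialP i Hu.
apply: weak_partialE => //.
have s0 : L2 Omega (fun=> 0) by exact: sqi_cst.
have := is_weak_partial_lin 1 (proj1 Hu) (sqi_cst mO (- k) finO) sg s0 wg (is_weak_partial_cst i (- k)).
by congr is_weak_partial; apply/funext => x; rewrite mul1r ?addr0.
Qed.

Lemma integrable_grad_dot u v : H1 Omega u -> H1 Omega v ->
  leb.-integrable Omega (EFin \o grad_dot Omega u v).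
Proof.
move=> Hu Hv.
rewrite (_ : EFin \o _ = fun x => (\sum_(i <- index_enum 'I_N) (weak_partial Omega i u x * weak_partial Omega i v x)%:E)%E).
  apply: integrable_sum => // i _.
  by apply: integrableM_sqi => //; [have [] := weak_partialP i Hu|have [] := weak_partialP i Hv].
by apply/funext => x; rewrite /= /grad_dot sumEFin.
Qed.

Lemma grad_dot_ge0 u x : 0 <= grad_dot Omega u u x.
Proof. by apply: sumr_ge0 => i _; rewrite -expr2 sqr_ge0. Qed.

Lemma measurable_grad_dot u v : H1 Omega u -> H1 Omega v ->
  measurable_fun Omega (grad_dot Omega u v).
Proof. by move=> Hu Hv; have /integrableP[/measurable_EFinP] := integrable_grad_dot Hu Hv. Qed.

Lemma ae_forall_ord (P : 'I_N -> 'rV[R]_N -> Prop) :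
  (forall i, {ae leb, forall x, P i x}) -> {ae leb, forall x i, P i x}.
Proof. by move=> h; apply: filter_forall. Qed.

Lemma grad_dot_lin (a : R) u v w : H1 Omega u -> H1 Omega v ->
  {ae leb, forall x, Omega x -> grad_dot Omega w (fun x => a * u x + v x) x =
    a * grad_dot Omega w u x + grad_dot Omega w v x}.
Proof.
move=> Hu Hv; have := ae_forall_ord (fun i => weak_partial_lin i a Hu Hv).
apply: filterS => x h Ox; rewrite /grad_dot mulr_sumr -big_split/=.
by apply: eq_bigr => i _; rewrite h//; ring.
Qed.

Lemma grad_dotC u v x : grad_dot Omega u v x = grad_dot Omega v u x.
Proof. by apply: eq_bigr => i _; rewrite mulrC. Qed.

Lemma Rintegral_grad_dot_subr u (k : R) : H1 Omega u ->
  \int[leb]_(x in Omega) grad_dot Omega (fun x => u x - k) (fun x => u x - k) x =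
  \int[leb]_(x in Omega) grad_dot Omega u u x.
Proof.
move=> Hu; have Hk : H1 Omega (fun x => u x - k).
  by have := H1_lin 1 Hu (H1_cst (- k)); under eq_fun do rewrite mul1r.
apply: ae_eq_Rintegral => //; [exact: measurable_grad_dot..|].
have := ae_forall_ord (fun i => weak_partial_addC i k Hu).
by apply: filterS => x h Ox; apply: eq_bigr => i _; rewrite h.
Qed.

End weak_derivatives.

Lemma Rintegral_sum d (T : measurableType d) (R : realType)
    (mu : {measure set T -> \bar R}) (D : set T) (mD : measurable D)
    (I : Type) (s : seq I) (F : I -> T -> R) :
  (forall i, mu.-integrable D (EFin \o F i)) ->
  \int[mu]_(x in D) (\sum_(i <- s) F i x) = \sum_(i <- s) \int[mu]_(x in D) F i x.
Proof.
move=> iF; elim: s => [|i s IH].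
  under eq_Rintegral do rewrite big_nil.
  by rewrite big_nil (Rintegral_cst mu mD) mul0r.
under eq_Rintegral do rewrite big_cons.
rewrite big_cons RintegralD ?IH//.
rewrite (_ : EFin \o _ = fun x => (\sum_(i <- s) (F i x)%:E)%E).
  by apply: integrable_sum => // k _; exact: iF.
by apply/funext => x; rewrite /= sumEFin.
Qed.

(** * The translation estimate *)

Section translation.
Context (R : realType) (N : nat) (Omega : set 'rV[R]_N).
Let leb := lebesgue_rV R N.
Context (oO : open Omega) (finO : (leb Omega < +oo)%E).
Let mO : measurable Omega := open_rV_measurable oO.
Implicit Types (u v g h : 'rV[R]_N -> R) (x y z : 'rV[R]_N).

Lemma flat_alg_sum (I : Type) (s : seq I) (F : I -> 'rV[R]_N -> R) :
  (forall k, flat_alg (F k)) -> flat_alg (fun x => \sum_(k <- s) F k x).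
Proof.
move=> SF; elim: s => [|k s IH].
  by under eq_fun do rewrite big_nil; exact: flat_alg_cst.
by under eq_fun do rewrite big_cons; exact: flat_algD.
Qed.

(** The nonnegative sum of the squares (S b_i - P a_i)^2 equals S (S B - P^2); divide by S. *)
Lemma sqr_dot_le (a b : 'I_N -> R) :
  (\sum_i a i * b i) ^+ 2 <= (\sum_i a i ^+ 2) * \sum_i b i ^+ 2.
Proof.
set S := \sum_i a i ^+ 2; set B := \sum_i b i ^+ 2; set P := \sum_i a i * b i.
have S0 : 0 <= S by apply: sumr_ge0 => i _; exact: sqr_ge0.
have [S_eq0|S_neq0] := eqVneq S 0.
  rewrite S_eq0 mul0r /P big1 ?expr0n// => i _.
  move/eqP: S_eq0; rewrite psumr_eq0; last by move=> j _; exact: sqr_ge0.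
  by move=> /allP/(_ i (mem_index_enum i)); rewrite sqrf_eq0 => /eqP ->; rewrite mul0r.
have : 0 <= \sum_i (S * b i - P * a i) ^+ 2 by apply: sumr_ge0 => i _; exact: sqr_ge0.
have -> : \sum_i (S * b i - P * a i) ^+ 2 =
    \sum_i (S ^+ 2 * b i ^+ 2 + - (2 * S * P) * (a i * b i) + P ^+ 2 * a i ^+ 2).
  by apply: eq_bigr => i _; ring.
rewrite !big_split/= -!mulr_sumr -/S -/B -/P.
have -> : S ^+ 2 * B + - (2 * S * P) * P + P ^+ 2 * S = S * (S * B - P ^+ 2) by ring.
by rewrite pmulr_rge0 ?subr_ge0// lt_def S_neq0.
Qed.

Section shift.
Context (A : set 'rV[R]_N) (z : 'rV[R]_N).
Hypothesis mA : measurable A.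
Hypothesis AzO : forall x, A x -> Omega (x + z).

Lemma L2_shift u : L2 Omega u -> L2 A (fun x => u (x + z)).
Proof.
move=> [mu u2]; split.
  apply: (measurable_comp mO) mu _; last first.
    by apply: measurable_funTS; exact: measurable_rV_shift.
  by move=> _ [x Ax <-]; exact: AzO.
apply: le_lt_trans u2.
rewrite -(ge0_integral_rV_shift z mO (f := fun x => (u x ^+ 2)%:E)); last 2 first.
- by apply/measurable_EFinP; exact: measurable_funX.
- by move=> x _; rewrite lee_fin sqr_ge0.
apply: ge0_subset_integral => //.
- rewrite -[X in measurable X]setTI; exact: measurable_rV_shift.
- apply/measurable_EFinP; apply: measurable_funX; apply: (measurable_comp mO) mu _.
    by move=> _ [x Ax <-].
  by apply: measurable_funTS; exact: measurable_rV_shift.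
- by move=> x _; rewrite lee_fin sqr_ge0.
Qed.

Lemma Rintegral_shift_support g (psi : 'rV[R]_N -> R) : measurable_fun Omega g ->
  measurable_fun setT psi -> (forall x, ~ A x -> psi x = 0) ->
  \int[leb]_(y in Omega) (g y * psi (y - z)) = \int[leb]_(x in A) (g (x + z) * psi x).
Proof.
move=> mg mpsi psiA.
rewrite -(integral_rV_shift z mO); last first.
  apply: measurable_funM => //; apply: measurable_funTS.
  exact: measurableT_comp mpsi (measurable_rV_shift (- z)).
under eq_Rintegral do rewrite addrK.
apply: Rintegral_support => //.
- rewrite -[X in measurable X]setTI; exact: measurable_rV_shift.
- by move=> x _ /psiA ->; rewrite mulr0.
- by move=> x /AzO.
Qed.

End shift.

Lemma flat_test_shift (A B : set 'rV[R]_N) psi z : flat_test A psi ->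
  (forall x, A x -> B (x + z)) -> flat_test B (fun y => psi (y - z)).
Proof.
move=> [Sp [K [cK KA psiK]]] ABz; split; first exact: flat_alg_shift.
exists ((fun x => x + z) @` K); split.
- apply: continuous_compact => //; apply: continuous_subspaceT => x.
  exact: (cvgD (@cvg_id _ (nbhs x)) (cvg_cst z)).
- by move=> _ [x Kx <-]; apply/ABz/KA.
- move=> y nKy; apply: psiK => Ky; apply: nKy; exists (y - z) => //.
  by rewrite subrK.
Qed.

(* For a test function psi on A, the derivative of [t |-> \int u psi(. - t z)]
   is [\int (z . grad u) psi(. - t z)]; a bound on it gives one on
   [\int (u(. + z) - u) psi], and testing against all psi suffices. *)
Lemma translation_le (A : set 'rV[R]_N) z u : open A -> A `<=` Omega ->
  (forall x t, A x -> 0 <= t <= 1 -> Omega (x + t *: z)) -> H1 Omega u ->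
  \int[leb]_(x in A) (u (x + z) - u x) ^+ 2 <=
  (\sum_i z ord0 i ^+ 2) * \int[leb]_(x in Omega) grad_dot Omega u u x.
Proof.
move=> oA AO AzO Hu; have mA := open_rV_measurable oA.
have finA : (leb A < +oo)%E.
  by apply: le_lt_trans finO; apply: le_measure; rewrite ?inE.
have [su _] := Hu; have mu_ : measurable_fun Omega u by case: su.
have AzO1 x : A x -> Omega (x + z).
  by move=> Ax; have := AzO x 1 Ax; rewrite scale1r; apply; rewrite ler01 lexx.
have suA : L2 A u.
  split; first exact: measurable_funS mu_.
  apply: le_lt_trans (proj2 su); apply: ge0_subset_integral => //.
    by apply/measurable_EFinP; exact: measurable_funX.
  by move=> x _; rewrite lee_fin sqr_ge0.
have sD : L2 A (fun x => u (x + z) - u x).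
  by apply: sqiB => //; exact: L2_shift.
pose G x := \sum_i z ord0 i * weak_partial Omega i u x.
have mw i : measurable_fun Omega (weak_partial Omega i u).
  by have [[]] := weak_partialP i Hu.
have G2 x : G x ^+ 2 <= (\sum_i z ord0 i ^+ 2) * grad_dot Omega u u x.
  rewrite /grad_dot; under [X in _ <= _ * X]eq_bigr do rewrite -expr2.
  exact: sqr_dot_le.
have iG : leb.-integrable Omega
    (EFin \o (fun x => (\sum_i z ord0 i ^+ 2) * grad_dot Omega u u x)).
  exact: (integrableZl mO (\sum_i z ord0 i ^+ 2) (integrable_grad_dot oO Hu Hu)).
have sG : L2 Omega G.
  have mG : measurable_fun Omega G.
    by apply: measurable_sum => i; apply: measurable_funM.
  apply: sqi_integrable => //; apply: (le_integrable mO _ _ iG).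
    by apply/measurable_EFinP; exact: measurable_funX.
  move=> x _; rewrite /= lee_fin ger0_norm ?sqr_ge0// (le_trans (G2 x))//.
  exact: ler_norm.
apply: (sqi_dual_le oA finA sD) => psi tpsi.
have [Sp [K [cK KA psiK]]] := tpsi.
have psiA x : ~ A x -> psi x = 0 by move=> nA; apply: psiK => /KA.
have mpsi : measurable_fun setT psi by exact: flat_alg_measurable.
have sp := flat_test_sqi mA finA tpsi.
pose dpsi x := - \sum_i z ord0 i * partial i psi x.
have Sdpsi : flat_alg dpsi.
  rewrite /dpsi; under eq_fun do rewrite -mulN1r.
  apply: flat_algM; first exact: flat_alg_cst.
  apply: flat_alg_sum => i; apply: flat_algM; first exact: flat_alg_cst.
  exact: flat_alg_partial.
have [C [C0 psiC]] := flat_alg_bounded Sp.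
have [C' [C'0 dpsiC]] := flat_alg_bounded Sdpsi.
pose F (t : R) := \int[leb]_(y in Omega) (u y * psi (y - t *: z)).
have dF (t : R) : is_derive t 1 F (\int[leb]_(y in Omega) (u y * dpsi (y - t *: z))).
  apply: (@is_derive_integral _ _ _ leb Omega mO u (fun t y => psi (y - t *: z))
    (fun t y => dpsi (y - t *: z)) (C + C')).
  - exact: addr_ge0.
  - exact: (sqi_integrable1 mO finO su).
  - move=> s; apply: measurable_funTS.
    exact: measurableT_comp mpsi (measurable_rV_shift _).
  - by move=> s x; rewrite (le_trans (psiC _))// lerDl.
  - by move=> s x; exact: is_derive_line.
  - by move=> s x; rewrite (le_trans (dpsiC _))// lerDr.
have F01 : F 1 - F 0 = \int[leb]_(x in A) ((u (x + z) - u x) * psi x).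
  rewrite /F scale1r (Rintegral_shift_support mA AzO1)//.
  under [X in _ - X]eq_Rintegral do rewrite scale0r subr0.
  rewrite [X in _ - X](@Rintegral_support _ _ _ A)//; last 2 first.
    by move=> x _ /psiA ->; rewrite mulr0.
    by move=> x /AO.
  rewrite -RintegralB//; [|exact: (integrableM_sqi mA (L2_shift mA AzO1 su) sp)|
    exact: integrableM_sqi].
  by apply: eq_Rintegral => x _; rewrite mulrBl.
(* The mean value theorem reduces the whole segment of translations to the single translate by c
   z. *)
have [c c01 Fc] : exists2 c, c \in `[0, 1] & F 1 - F 0 =
    (\int[leb]_(y in Omega) (u y * dpsi (y - c *: z))) * (1 - 0).
  apply: MVT_segment => //; apply: derivable_within_continuous => t _.
  exact: (@ex_derive _ _ _ _ _ _ _ (dF t)).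
rewrite -F01 Fc subr0 mulr1.
have AcO x : A x -> Omega (x + c *: z) by move=> Ax; apply: AzO; rewrite -?in_itv.
have tc : flat_test Omega (fun y => psi (y - c *: z)) := flat_test_shift tpsi AcO.
have tfc := flat_test_test_function (@subset_refl _ Omega) tc.
have sc := flat_test_sqi mO finO tc.
(* Integration by parts: psi (. - c z) is still a test function on Omega, so the definition of the
   weak derivatives of u applies to it. *)
rewrite [X in X <= _](_ : _ = \int[leb]_(y in Omega) (G y * psi (y - c *: z))); last first.
  have scp i := test_function_partial_sqi i mO finO tfc.
  have swp i := proj1 (weak_partialP i Hu).
  rewrite /G; under [RHS]eq_Rintegral do rewrite mulr_suml.
  have dpsiE y : u y * dpsi (y - c *: z) =
      \sum_i - z ord0 i * (u y * partial i (fun y => psi (y - c *: z)) y).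
    rewrite /dpsi mulrN mulr_sumr -sumrN; apply: eq_bigr => i _.
    by rewrite partial_shift; ring.
  under eq_Rintegral do rewrite dpsiE.
  rewrite (Rintegral_sum mO); last first.
    by move=> i; exact: (integrableZl mO (- z ord0 i) (integrableM_sqi mO su (scp i))).
  rewrite (Rintegral_sum mO); last first.
    move=> i; under eq_fun do rewrite -mulrA.
    exact: (integrableZl mO (z ord0 i) (integrableM_sqi mO (swp i) sc)).
  apply: eq_bigr => i _; rewrite RintegralZl//; last exact: integrableM_sqi.
  rewrite (proj2 (weak_partialP i Hu) _ tfc) mulrNN.
  rewrite -(RintegralZl _ mO (integrableM_sqi mO (swp i) sc)).
  by apply: eq_Rintegral => y _; rewrite mulrA.
(* With e = 1 both factors are 1 / 2, as [sqi_dual_le] requires. *)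
have := RintegralM_le mO ltr01 sG sc; move=> /le_trans; apply.
rewrite mul1r mulr1 [X in _ + _ * X](_ : _ = \int[leb]_(x in A) psi x ^+ 2); last first.
  under eq_Rintegral do rewrite -[_ ^+ 2]mul1r.
  rewrite (Rintegral_shift_support mA AcO (g := fun=> 1) (psi := fun x => psi x ^+ 2))//.
  - by under eq_Rintegral do rewrite mul1r.
  - exact: measurable_funX.
  - by move=> x /psiA ->; rewrite expr0n.
rewrite lerD2r mulrC ler_pdivlMr// mulfVK//.
rewrite -RintegralZl//; last exact: integrable_grad_dot.
by apply: le_Rintegral => //; exact: integrable_sqi.
Qed.

End translation.

Section Rintegral_domain.
Context d (T : measurableType d) (R : realType).
Context (mu : {measure set T -> \bar R}).

Lemma ge0_Rintegral_subset (A B : set T) (f : T -> R) : measurable A -> measurable B ->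
  A `<=` B -> (forall x, B x -> 0 <= f x) -> mu.-integrable B (EFin \o f) ->
  \int[mu]_(x in A) f x <= \int[mu]_(x in B) f x.
Proof.
move=> mA mB AB f0 fB; have fA : mu.-integrable A (EFin \o f) by exact: integrableS fB.
apply: fine_le; [exact: integrable_fin_num fA|exact: integrable_fin_num fB|].
by apply: ge0_subset_integral => //; have /integrableP[] := fB.
Qed.

Lemma ge0_Rintegral_setU_le (A B : set T) (f : T -> R) : measurable A -> measurable B ->
  (forall x, (A `|` B) x -> 0 <= f x) -> mu.-integrable (A `|` B) (EFin \o f) ->
  \int[mu]_(x in A `|` B) f x <= \int[mu]_(x in A) f x + \int[mu]_(x in B) f x.
Proof.
move=> mA mB f0 fAB.
have mBA : measurable (B `\` A) by exact: measurableD.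
have E : A `|` B = A `|` (B `\` A).
  apply/seteqP; split => x; last by case=> [Ax|[Bx _]]; [left|right].
  by case=> [Ax|Bx]; [left|have [Ax|nAx] := pselect (A x); [left|right]].
rewrite {1}E Rintegral_setU//; last 2 first.
- by rewrite -E.
- by apply/disj_set2P; rewrite setIDA setIC -setIDA setDv setI0.
rewrite lerD2l; apply: ge0_Rintegral_subset => //.
- by move=> x Bx; apply: f0; right.
- by apply: integrableS fAB => //; exact: measurableU.
Qed.

Lemma square_integrableS (A B : set T) (f : T -> R) : measurable A -> measurable B ->
  A `<=` B -> square_integrable mu B f -> square_integrable mu A f.
Proof.
move=> mA mB AB sf; apply: sqi_integrable => //; last exact: integrableS (integrable_sqi mB sf).
by apply: measurable_funS (proj1 sf).
Qed.

Lemma Rintegral_sqr_subset (A B : set T) (f : T -> R) : measurable A -> measurable B ->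
  A `<=` B -> square_integrable mu B f ->
  \int[mu]_(x in A) f x ^+ 2 <= \int[mu]_(x in B) f x ^+ 2.
Proof.
move=> mA mB AB sf; apply: ge0_Rintegral_subset => //.
- by move=> x _; exact: sqr_ge0.
- exact: integrable_sqi.
Qed.

(** Otherwise h - c would be positive on D with integral at most 0, hence zero almost everywhere on
    a set of positive measure. On a cube this supplies the base point y whose value u (y) is the
    constant to subtract. *)
Lemma exists_le_average (D : set T) (h : T -> \bar R) (c : R) : measurable D ->
  (0 < mu D < +oo)%E -> measurable_fun D h -> 0 <= c ->
  (\int[mu]_(x in D) h x <= c%:E * mu D)%E ->
  exists2 y, D y & (h y <= c%:E)%E.
Proof.
move=> mD /andP[D0 Doo] mh c0 hc; apply: contrapT => no.
have ch y : D y -> (c%:E < h y)%E.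
  by move=> Dy; rewrite ltNge; apply/negP => hy; apply: no; exists y.
pose g y := (h y - c%:E)%E.
have mg : measurable_fun D g by exact: emeasurable_funB.
have g0 y : D y -> (0 <= g y)%E by move=> Dy; rewrite sube_ge0// ltW// ch.
have : (\int[mu]_(x in D) `|g x| = 0)%E.
  apply/eqP; rewrite eq_le integral_ge0// andbT.
  rewrite (_ : integral _ _ _ = \int[mu]_(x in D) g x)%E; last first.
    by apply: eq_integral => x; rewrite inE => Dx; rewrite gee0_abs// g0.
  have E : (\int[mu]_(x in D) h x = \int[mu]_(x in D) g x + c%:E * mu D)%E.
    rewrite -(integral_cst mu mD) -ge0_integralD//.
    apply: eq_integral => x _.
    by rewrite -[RHS]/((h x - c%:E) + c%:E)%E subeK.
  move: hc; rewrite E -[leRHS]add0e leeD2rE// fin_numM//.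
  by rewrite ge0_fin_numE// ltW.
move=> /(ae_eq_integral_abs mu mD mg)[B [mB B0 DB]].
have : (mu D <= mu B)%E.
  apply: le_measure; rewrite ?inE// => x Dx; apply: DB => /= /(_ Dx) /eqP.
  have : (0 < g x)%E by rewrite sube_gt0 ch.
  by move=> /gt_eqF ->.
by rewrite B0 leNgt D0.
Qed.

End Rintegral_domain.

(** * The Poincare-Wirtinger inequality *)

Section poincare_on.
Context (R : realType) (N : nat) (Omega : set 'rV[R]_N).
Let leb := lebesgue_rV R N.
Context (oO : open Omega) (finO : (leb Omega < +oo)%E).
Let mO : measurable Omega := open_rV_measurable oO.
Implicit Types (A B G : set 'rV[R]_N) (u : 'rV[R]_N -> R) (z : 'rV[R]_N).

Definition energy u := \int[leb]_(x in Omega) grad_dot Omega u u x.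

Lemma energy_ge0 u : 0 <= energy u.
Proof. by apply: Rintegral_ge0 => x _; exact: grad_dot_ge0. Qed.

(** The energy is taken over all of Omega, not over A: a piece may then be controlled along segments
    that leave it, and gluing pieces only changes C. The constant k may depend on u and on A, but C
    must not depend on u. *)
Definition poincare_on A := [/\ measurable A, A `<=` Omega &
  exists C, 0 <= C /\ forall u, H1 Omega u ->
    exists k, \int[leb]_(x in A) (u x - k) ^+ 2 <= C * energy u].

Lemma H1_sqi_subr u k : H1 Omega u -> L2 Omega (fun x => u x - k).
Proof. by move=> [su _]; apply: sqiB => //; exact: sqi_cst. Qed.

Lemma poincare_onS A B : measurable A -> A `<=` B -> poincare_on B -> poincare_on A.
Proof.
move=> mA AB [mB BO [C [C0 HC]]]; split => //; first exact: subset_trans BO.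
exists C; split => // u Hu; have [k HCk] := HC u Hu; exists k.
apply: le_trans HCk; apply: Rintegral_sqr_subset => //.
exact: square_integrableS (H1_sqi_subr k Hu).
Qed.

(** The two subtracted constants are compared on the overlap of measure m: writing k' - k as (u - k)
    - (u - k') gives m (k' - k)^2 <= 2 (C + C') E. Replacing k' by k on B then costs this bound
    times the measure of B. *)
Lemma poincare_onU A B : (0 < leb (A `&` B))%E ->
  poincare_on A -> poincare_on B -> poincare_on (A `|` B).
Proof.
move=> AB0 [mA AO [C [C0 HC]]] [mB BO [C' [C'0 HC']]].
have mAB : measurable (A `&` B) by exact: measurableI.
have ABO : A `&` B `<=` Omega by move=> x [/AO].
split; [exact: measurableU|by move=> x [/AO|/BO]|].
have fin X : measurable X -> X `<=` Omega -> (leb X < +oo)%E.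
  by move=> mX XO; apply: le_lt_trans finO; apply: le_measure; rewrite ?inE.
have finR X : measurable X -> X `<=` Omega -> (leb X)%E = (fine (leb X))%:E.
  by move=> mX XO; rewrite fineK// ge0_fin_numE// fin.
pose m := fine (leb (A `&` B)).
have m0 : 0 < m by rewrite -lte_fin -finR.
pose mu_B := fine (leb B).
have muB0 : 0 <= mu_B by exact: fine_ge0.
exists (C + 2 * C' + 2 * ((2 * (C + C')) / m) * mu_B); split.
  have q0 : 0 <= 2 * (C + C') / m by rewrite divr_ge0 ?mulr_ge0 ?addr_ge0// ltW.
  apply: addr_ge0; last by apply: mulr_ge0 => //; exact: mulr_ge0.
  by apply: addr_ge0 => //; exact: mulr_ge0.
move=> u Hu; have [k Hk] := HC u Hu; have [k' Hk'] := HC' u Hu.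
exists k; have E0 := energy_ge0 u; set E := energy u in Hk Hk' E0 *.
have sub X l : measurable X -> X `<=` Omega -> square_integrable leb X (fun x => u x - l).
  by move=> mX XO; exact: square_integrableS (H1_sqi_subr l Hu).
have cstI X l : measurable X -> X `<=` Omega -> \int[leb]_(x in X) l = l * fine (leb X).
  by move=> mX XO; exact: Rintegral_cst.
have kk : (k' - k) ^+ 2 * m <= 2 * (C + C') * E.
  rewrite -cstI//.
  have := Rintegral_sqrD_le mAB (sub _ k mAB ABO) (sqiZ mAB (-1) (sub _ k' mAB ABO)).
  rewrite [X in X <= _](_ : _ = \int[leb]_(x in A `&` B) (k' - k) ^+ 2); last first.
    by apply: eq_Rintegral => x _; ring.
  move=> /le_trans; apply.
  rewrite (_ : 2 * (C + C') * E = 2 * (C * E) + 2 * (C' * E)); last by ring.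
  apply: lerD; rewrite ler_wpM2l//.
    apply: le_trans Hk; apply: Rintegral_sqr_subset => //; exact: sub.
  apply: le_trans Hk'; under eq_Rintegral do rewrite mulN1r sqrrN.
  apply: Rintegral_sqr_subset => //; exact: sub.
have Bk : \int[leb]_(x in B) (u x - k) ^+ 2 <= 2 * (C' * E) + 2 * ((k' - k) ^+ 2 * mu_B).
  rewrite (_ : Rintegral _ _ _ = \int[leb]_(x in B) ((u x - k') + (k' - k)) ^+ 2); last first.
    by apply: eq_Rintegral => x _; ring.
  have := Rintegral_sqrD_le mB (sub _ k' mB BO) (sqi_cst mB (k' - k) (fin _ mB BO)).
  move=> /le_trans; apply; rewrite cstI// lerD2r ler_wpM2l//.
apply: (le_trans (ge0_Rintegral_setU_le _ _ _ _)) => //.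
- by move=> x _; exact: sqr_ge0.
- by apply: integrable_sqi; [exact: measurableU|apply: sub; [exact: measurableU|move=> x [/AO|/BO]]].
have : (k' - k) ^+ 2 * mu_B <= (2 * (C + C')) / m * E * mu_B.
  by rewrite ler_wpM2r// mulrAC ler_pdivlMr.
move: Hk Bk; lra.
Qed.

(** Write u - k as (u (. + z) - k) - (u (. + z) - u): the first term lives on G after translation,
    the second is the translation estimate. *)
Lemma poincare_on_shift A G z : open A -> A `<=` Omega ->
  (forall x t, A x -> 0 <= t <= 1 -> Omega (x + t *: z)) ->
  (forall x, A x -> G (x + z)) -> poincare_on G -> poincare_on A.
Proof.
move=> oA AO AzO AzG [mG GO [C [C0 HC]]]; have mA := open_rV_measurable oA.
split => //; exists (2 * \sum_i z ord0 i ^+ 2 + 2 * C); split.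
  by rewrite addr_ge0// mulr_ge0// sumr_ge0// => i _; exact: sqr_ge0.
move=> u Hu; have [k Hk] := HC u Hu; exists k.
have sA : square_integrable leb A u by exact: square_integrableS (proj1 Hu).
have AzO1 x : A x -> Omega (x + z) by move=> /AzG/GO.
have sz l : square_integrable leb A (fun x => u (x + z) - l).
  exact: (L2_shift oO mA AzO1 (H1_sqi_subr l Hu)).
have szu : square_integrable leb A (fun x => u (x + z) - u x).
  apply: sqiB => //; exact: (L2_shift oO mA AzO1 (proj1 Hu)).
rewrite (_ : Rintegral _ _ _ = \int[leb]_(x in A)
    (-1 * (u (x + z) - u x) + (u (x + z) - k)) ^+ 2); last first.
  by apply: eq_Rintegral => x _; ring.
apply: (le_trans (Rintegral_sqrD_le mA (sqiZ mA (-1) szu) (sz k))).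
have -> : (2 * (\sum_i z ord0 i ^+ 2) + 2 * C) * energy u =
  2 * ((\sum_i z ord0 i ^+ 2) * energy u) + 2 * (C * energy u) by ring.
apply: lerD; rewrite ler_wpM2l//.
  under eq_Rintegral do rewrite mulN1r sqrrN.
  exact: (translation_le oO finO oA AO AzO Hu).
apply: le_trans Hk.
have sG : square_integrable leb G (fun x => u x - k).
  exact: square_integrableS (H1_sqi_subr k Hu).
rewrite -(integral_rV_shift z mG); last by apply: measurable_funX; case: sG.
have mGz : measurable ((fun x : 'rV[R]_N => x + z) @^-1` G).
  by rewrite -[X in measurable X]setTI; exact: measurable_rV_shift.
apply: Rintegral_sqr_subset => //.
have GzO x : ((fun x : 'rV[R]_N => x + z) @^-1` G) x -> Omega (x + z) by move=> /GO.
exact: (L2_shift oO mGz GzO (H1_sqi_subr k Hu)).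
Qed.

End poincare_on.

(** * The inequality on cubes *)

Section poincare_cube.
Context (R : realType) (N : nat) (Omega : set 'rV[R]_N).
Let leb := lebesgue_rV R N.
Context (oO : open Omega) (finO : (leb Omega < +oo)%E).

Lemma cube_segment (a x z : 'rV[R]_N) (r t : R) : cube a r x -> cube a r (x + z) ->
  0 <= t <= 1 -> cube a r (x + t *: z).
Proof.
move=> xr xzr /andP[t0 t1] i; have := xr i; have := xzr i.
rewrite !mxE !ltr_norml => /andP[h1 h2] /andP[h3 h4].
(* x + t z is the combination of x and x + z with weights 1 - t and t; strictness comes from x
   unless its weight is 0. *)
have [->|tneq1] := eqVneq t 1; first by rewrite mul1r h1 h2.
have {}t1 : 0 < 1 - t by rewrite subr_gt0 lt_neqAle tneq1.
by apply/andP; split; nra.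
Qed.

Lemma measurable_rV_add :
  measurable_fun setT (fun p : 'rV[R]_N * 'rV[R]_N => p.1 + p.2).
Proof.
apply: measurable_fun_coordP => i; under eq_fun do rewrite mxE.
apply: measurable_funD.
  exact: measurableT_comp (measurable_coord i) (@measurable_fst _ _ _ _).
exact: measurableT_comp (measurable_coord i) (@measurable_snd _ _ _ _).
Qed.

(* Averaging over the base point y of [\int_Q (u - u(y))^2], the substitution
   y = x + z reduces to the translation estimate, integrated over z. *)
Lemma poincare_on_cube (a : 'rV[R]_N) (r : R) : 0 < r -> cube a r `<=` Omega ->
  poincare_on Omega (cube a r).
Proof.
move=> r0; set Q := cube a r => QO.
have mQ : measurable Q := measurable_cube a r.
have oQ : open Q by rewrite /Q -ball_cube//; exact: ball_open.
(* K bounds |z|^2 for differences z of points of Q, M is the volume of the cube containing these z,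
   and m the volume of Q, by which the average over base points divides. *)
pose K := N%:R * (r *+ 2) ^+ 2.
pose m := (r *+ 2) ^+ N.
pose M := (r *+ 2 *+ 2) ^+ N.
have r2 : 0 < r *+ 2 by rewrite pmulrn_lgt0.
have r4 : 0 < r *+ 2 *+ 2 by rewrite pmulrn_lgt0.
have m0 : 0 < m by exact: exprn_gt0.
have K0 : 0 <= K by rewrite mulr_ge0// sqr_ge0.
have lebQ : leb Q = m%:E by exact: lebesgue_rV_cube.
have finQ : (leb Q < +oo)%E by rewrite lebQ ltry.
have C0 : 0 <= K * M / m by rewrite divr_ge0 ?mulr_ge0 ?exprn_ge0// ltW.
split => //; exists (K * M / m); split => // u Hu.
have E0 := energy_ge0 Omega u; set E := energy Omega u in E0 *.
have suQ : square_integrable leb Q u.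
  by apply: square_integrableS (proj1 Hu) => //; exact: open_rV_measurable.
(* Tonelli needs a function measurable on the whole space, so u is extended by 0 outside Q. *)
have [v [mv vQ]] : exists v : 'rV[R]_N -> R,
    measurable_fun setT v /\ forall x, Q x -> v x = u x.
  have := iffLR (measurable_restrictT u mQ) (proj1 suQ).
  set v := u \_ Q => mv; exists v; split => //.
  by move=> x Qx; rewrite /v patchE mem_set.
pose Phi (p : 'rV[R]_N * 'rV[R]_N) : \bar R :=
  (\1_Q p.1 * \1_Q (p.1 + p.2) * (v (p.1 + p.2) - v p.1) ^+ 2)%:E.
have Phi0 p : (0 <= Phi p)%E by rewrite lee_fin; apply: mulr_ge0; [exact: mulr_ge0|exact: sqr_ge0].
have m1Q : measurable_fun setT (\1_Q : 'rV[R]_N -> R) by exact: measurable_indic.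
have mfst : measurable_fun setT (fst : 'rV[R]_N * 'rV[R]_N -> 'rV[R]_N).
  exact: measurable_fst.
have mPhi : measurable_fun setT Phi.
  apply/measurable_EFinP; apply: measurable_funM.
    apply: measurable_funM; first exact: measurableT_comp m1Q mfst.
    exact: measurableT_comp m1Q measurable_rV_add.
  apply: measurable_funX; apply: measurable_funB.
    exact: measurableT_comp mv measurable_rV_add.
  exact: measurableT_comp mv mfst.
pose h x := (\int[leb]_z Phi (x, z))%E.
have hE y : Q y -> h y = (\int[leb]_(x in Q) ((u x - u y) ^+ 2)%:E)%E.
  move=> Qy; pose G x := (\1_Q x * (v x - v y) ^+ 2)%:E.
  have mG : measurable_fun setT G.
    apply/measurable_EFinP; apply: measurable_funM => //.
    by apply: measurable_funX; exact: measurable_funB.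
  have G0 x : (0 <= G x)%E by rewrite lee_fin; apply: mulr_ge0 => //; exact: sqr_ge0.
  transitivity (\int[leb]_x G x)%E.
    rewrite -(@ge0_integral_rV_shift _ _ y setT G)// preimage_setT.
    by apply: eq_integral => z _; rewrite /Phi /G/= (addrC z y) [\1_Q y]indicE mem_set// mul1r.
  rewrite [RHS]integral_mkcond/=; apply: eq_integral => x _.
  rewrite patchE /G indicE; case: ifPn => [|_]; last by rewrite mul0r.
  by rewrite inE => Qx; rewrite mul1r !vQ.
(* For fixed z the integral runs over Q and its translate by - z, which meet only if all coordinates
   of z are below 2 r in absolute value. Convexity of Q provides the segments for the translation
   estimate. *)
have PhiE z : (\int[leb]_x Phi (x, z) <= (K * E * \1_(cube 0 (r *+ 2)) z)%:E)%E.
  pose A := Q `&` (fun x => x + z) @^-1` Q.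
  have oA : open A.
    apply: openI => //; apply: open_comp => // x _.
    exact: (cvgD (@cvg_id _ (nbhs x)) (cvg_cst z)).
  have mA := open_rV_measurable oA.
  have -> : (\int[leb]_x Phi (x, z) = \int[leb]_(x in A) ((u (x + z) - u x) ^+ 2)%:E)%E.
    rewrite [RHS]integral_mkcond/=; apply: eq_integral => x _.
    rewrite /Phi/= patchE !indicE; case: ifPn => [|].
      by rewrite inE => -[Qx Qxz]; rewrite !mem_set// !mul1r !vQ.
    rewrite notin_setE => nA; have [Qx|nQx] := pselect (Q x).
      have nQxz : ~ Q (x + z) by move=> Qxz; apply: nA.
      by rewrite (memNset nQxz) mulr0 mul0r.
    by rewrite (memNset nQx) !mul0r.
  have [A0|/set0P[x [Qx Qxz]]] := eqVneq A set0.
    by rewrite A0 integral_set0 lee_fin mulr_ge0// mulr_ge0.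
  have z2 i : `|z ord0 i| < r *+ 2.
    have -> : z ord0 i = ((x + z) ord0 i - a ord0 i) - (x ord0 i - a ord0 i).
      by rewrite mxE; ring.
    by rewrite (le_lt_trans (ler_normB _ _))// mulr2n ltrD.
  rewrite indicE mem_set ?mulr1; last by move=> i; rewrite mxE subr0.
  have AO : A `<=` Omega by move=> y [/QO].
  have AzO (y : 'rV[R]_N) (t : R) : A y -> 0 <= t <= 1 -> Omega (y + t *: z).
    by move=> [Qy Qyz] t01; apply: QO; exact: cube_segment.
  have AzO1 (y : 'rV[R]_N) : A y -> Omega (y + z) by move=> [_ /QO].
  have sA : square_integrable leb A (fun x => u (x + z) - u x).
    apply: sqiB => //; first exact: (L2_shift oO mA AzO1 (proj1 Hu)).
    by apply: square_integrableS suQ => // y [].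
  rewrite -EFin_Rintegral_sqr// lee_fin.
  apply: (le_trans (translation_le oO finO oA AO AzO Hu)); rewrite ler_wpM2r//.
  rewrite /K mulr_natl -[X in _ *+ X]card_ord -sumr_const; apply: ler_sum => i _.
  have z2i := ltW (z2 i); have r2' := ltW r2.
  by rewrite -(real_normK (num_real _)) ler_pXn2r ?nnegrE.
have ih : (\int[leb]_(x in Q) h x <= (K * M / m * E)%:E * leb Q)%E.
  apply: (@le_trans _ _ (\int[leb]_x h x)%E).
    apply: ge0_subset_integral => //.
      exact: measurable_fun_fubini_tonelli_F.
    by move=> x _; apply: integral_ge0.
  rewrite /h (fubini_tonelli Phi mPhi Phi0).
  apply: (@le_trans _ _ (\int[leb]_z (K * E * \1_(cube 0 (r *+ 2)) z)%:E)%E).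
    apply: ge0_le_integral => //.
    - by move=> z _; exact: integral_ge0.
    - exact: measurable_fun_fubini_tonelli_G.
    - apply/measurable_EFinP; apply: measurable_funM => //.
      by apply: measurable_indic; exact: measurable_cube.
  under eq_integral do rewrite EFinM.
  rewrite ge0_integralZl//; last 2 first.
  - by apply/measurable_EFinP; apply: measurable_indic; exact: measurable_cube.
  - by rewrite lee_fin mulr_ge0.
  rewrite integral_indic//; last exact: measurable_cube.
  rewrite setIT [X in (_ * X)%E](lebesgue_rV_cube 0 r2) lebQ -!EFinM lee_fin.
  by rewrite le_eqVlt; apply/orP; left; apply/eqP; rewrite /M; field; rewrite gt_eqF.
have Q0oo : (0 < leb Q < +oo)%E by rewrite finQ andbT lebQ lte_fin.
have [||y Qy hy] := exists_le_average mQ Q0oo _ _ ih.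
- by apply: measurable_funTS; exact: measurable_fun_fubini_tonelli_F.
- exact: mulr_ge0.
exists (u y); rewrite -lee_fin EFin_Rintegral_sqr -?hE//.
by apply: sqiB => //; exact: sqi_cst.
Qed.

End poincare_cube.

(** * Pushing into the interior at a Lipschitz boundary point *)

Section poincare_lipschitz.
Context (R : realType) (N : nat) (Omega : set 'rV[R]_N).
Let leb := lebesgue_rV R N.

(** The crude factor n + 1 is positive for every n, so radii can be divided by it. *)
Lemma enorm_le n (w : 'rV[R]_n) (B : R) : 0 <= B -> (forall j, `|w ord0 j| <= B) ->
  enorm w <= n.+1%:R * B.
Proof.
move=> B0 wB; have nB0 : 0 <= n.+1%:R * B by rewrite mulr_ge0.
rewrite -(ger0_norm nB0) -sqrtr_sqr; apply: ler_wsqrtr.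
apply: (@le_trans _ _ (\sum_(j < n) B ^+ 2)).
  apply: ler_sum => j _; rewrite -(real_normK (num_real _)).
  by rewrite ler_pXn2r ?nnegrE.
rewrite sumr_const card_ord -[leLHS]mulr_natl exprMn ler_wpM2r ?sqr_ge0//.
by rewrite -natrX ler_nat (leq_trans (leqnSn n))// -{1}(expn1 n.+1) leq_pexp2l.
Qed.

(* Moving along the axis of the local graph stays inside Omega. *)
Lemma lipschitz_boundary_push (x0 : 'rV[R]_N) : lipschitz_boundary Omega ->
  boundary Omega x0 -> exists (r : R) (z : 'rV[R]_N), [/\ 0 < r, Omega (x0 + z) &
    forall x t, Omega x -> cube x0 r x -> 0 <= t <= 1 -> Omega (x + t *: z)].
Proof.
move=> lipO bx0; have [clx0 _] := bx0.
have [r0 [Q [i [f [L [r0_gt0 QQ fL Of]]]]]] := lipO _ bx0.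
pose rho := r0 / (2 * N.+1%:R).
have rho0 : 0 < rho by rewrite divr_gt0// mulr_gt0.
have near_enorm (y : 'rV[R]_N) : (forall j, `|y ord0 j| <= rho) -> enorm y < r0.
  move=> yrho; apply: (le_lt_trans (enorm_le (ltW rho0) yrho)).
  have n0 : 0 < N.+1%:R :> R by [].
  rewrite /rho; move: n0; set n := N.+1%:R => n0.
  rewrite (_ : n * _ = r0 / 2); last by field; rewrite gt_eqF.
  by rewrite gtr_pMr// invf_lt1// ltr1n.
(* The axis of the graph in the original coordinates; s below makes all coordinates of z at most rho
   / 2. *)
pose e : 'rV[R]_N := delta_mx ord0 i *m Q^T.
have eQ : e *m Q = delta_mx ord0 i.
  rewrite -mulmxA (_ : Q^T *m Q = 1%:M) ?mulmx1//.
  exact: mulmx1C.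
pose s := rho / (2 * (`|e| + 1)).
have e1 : 0 < `|e| + 1 by rewrite ltr_wpDl.
have s0 : 0 < s by rewrite divr_gt0// mulr_gt0.
pose z := s *: e.
have zrho j : `|z ord0 j| <= rho / 2.
  apply: (le_trans (normr_coord_le z j)); rewrite normrZ gtr0_norm//.
  have -> : rho / 2 = s * (`|e| + 1) by rewrite /s; field; rewrite gt_eqF.
  by rewrite ler_wpM2l ?lerDl// ltW.
have zQ x t : (x + t *: z) *m Q = x *m Q + (t * s) *: delta_mx ord0 i.
  by rewrite mulmxDl /z scalerA -scalemxAl eQ.
have colz x t : col' i ((x + t *: z) *m Q) = col' i (x *m Q).
  rewrite zQ; apply/rowP => j; rewrite !mxE eqxx/= eq_sym.
  by rewrite (negbTE (neq_lift _ _)) mulr0 addr0.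
have iz x t : ((x + t *: z) *m Q) ord0 i = (x *m Q) ord0 i + t * s.
  by rewrite zQ !mxE !eqxx mulr1.
pose q := N%:R * `|Q|.
have q0 : 0 <= q by rewrite mulr_ge0.
have xQ (y : 'rV[R]_N) (dl : R) : (forall j, `|y ord0 j| <= dl) ->
    forall j, `|(y *m Q) ord0 j| <= q * dl.
  move=> ydl j; rewrite mxE (le_trans (ler_norm_sum _ _ _))//.
  apply: (@le_trans _ _ (\sum_(k < N) `|Q| * dl)).
    apply: ler_sum => k _; rewrite normrM mulrC ler_pM//.
    rewrite [leRHS]/Num.norm /= mx_normrE.
    by apply: (le_trans _ (le_bigmax _ _ (k, j))).
  by rewrite sumr_const card_ord -[leLHS]mulr_natl mulrA.
(* Moving by at most dl in each coordinate changes the height over the graph by at most c dl: q dl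
   from the i-th rotated coordinate, the rest from f. The sign of L is not prescribed, hence its
   absolute value. *)
pose c := q + `|L| * (N.-1.+1%:R * q).
have c0 : 0 <= c by rewrite addr_ge0// mulr_ge0// mulr_ge0.
pose dl := Num.min rho (s / (c + 1)).
have c1 : 0 < c + 1 by rewrite ltr_wpDl.
have dl0 : 0 < dl by rewrite lt_min rho0 divr_gt0.
(* A point x of Omega within dl of x0 lies above the graph, so x0 lies less than c dl below it or
   above it. Since c dl < s, the push by z = s e lifts x0 strictly above. *)
have x0z : Omega (x0 + z).
  have [x [Ox xdl]] : (Omega `&` cube x0 dl) !=set0.
    apply: clx0; rewrite -ball_cube//; exact: nbhsx_ballx.
  have xle j : `|(x - x0) ord0 j| <= dl by rewrite !mxE ltW.
  have fx : f (col' i (x *m Q)) < (x *m Q) ord0 i.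
    apply/Of => //; apply: near_enorm => j.
    by rewrite (le_trans (xle j))// ge_min lexx.
  rewrite -[z]scale1r; apply/Of.
    apply: near_enorm => j; rewrite scale1r addrC addKr (le_trans (zrho j))//.
    by rewrite ler_piMr ?invf_le1 ?ler1n// ltW.
  rewrite colz iz mul1r.
  have yi := xQ _ _ xle i; have yj := xQ _ _ xle.
  have h1 : `|f (col' i (x *m Q)) - f (col' i (x0 *m Q))| <= `|L| * (N.-1.+1%:R * (q * dl)).
    apply: (le_trans (fL _ _)); apply: (@le_trans _ _ (`|L| * enorm (col' i (x *m Q) - col' i (x0 *m Q)))).
      by rewrite ler_wpM2r ?sqrtr_ge0// ler_norm.
    rewrite ler_wpM2l//; apply: enorm_le; first by rewrite mulr_ge0// ltW.
    move=> j; rewrite [X in `|X|](_ : _ = ((x - x0) *m Q) ord0 (lift i j))//.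
    by rewrite mulmxBl !mxE.
  have h2 : `|(x *m Q) ord0 i - (x0 *m Q) ord0 i| <= q * dl.
    rewrite [X in `|X|](_ : _ = ((x - x0) *m Q) ord0 i)//.
    by rewrite mulmxBl !mxE.
  have h3 : c * dl < s.
    apply: (@le_lt_trans _ _ (c * (s / (c + 1)))).
      by rewrite ler_wpM2l// ge_min lexx orbT.
    by rewrite mulrCA gtr_pMr// ltr_pdivrMr// mul1r ltrDl.
  have cE : c * dl = q * dl + `|L| * (N.-1.+1%:R * (q * dl)) by rewrite /c; ring.
  move: h1 h2; rewrite !ler_norml => /andP[h1 h1'] /andP[h2 h2'].
  move: fx h1 h2 h1' h2' h3; rewrite cE; lra.
(* Half of rho for the distance from x0, half for the push. *)
exists (rho / 2), z; split => //; first by rewrite divr_gt0.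
move=> x t Ox xrho /andP[t0 t1].
have near_t (y : R) j : 0 <= y -> y <= 1 -> `|(x + y *: z - x0) ord0 j| <= rho.
  move=> y0 y1; have -> : (x + y *: z - x0) ord0 j = (x ord0 j - x0 ord0 j) + y * z ord0 j.
    by rewrite addrAC !mxE.
  rewrite (le_trans (ler_normD _ _))// (splitr rho) lerD//; first exact/ltW/xrho.
  by rewrite normrM ger0_norm// (le_trans _ (zrho j))// ler_piMl.
apply/Of; first by apply: near_enorm => j; exact: near_t.
rewrite colz iz; apply: (@lt_le_trans _ _ ((x *m Q) ord0 i)).
  apply/Of => //; apply: near_enorm => j.
  by have := near_t 0 j (lexx 0) ler01; rewrite scale0r addr0.
by rewrite lerDl mulr_ge0// ltW.
Qed.

End poincare_lipschitz.

(** * From local inequalities to the whole domain *)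

Section poincare.
Context (R : realType) (N : nat) (Omega : set 'rV[R]_N).
Let leb := lebesgue_rV R N.
Context (dO : domain Omega) (bO : bounded_set Omega) (lipO : lipschitz_boundary Omega).

Let oO : open Omega. Proof. by case: dO. Qed.
Let mO : measurable Omega := open_rV_measurable oO.
Let finO : (leb Omega < +oo)%E := lebesgue_rV_bounded mO bO.

Let open_cube (x : 'rV[R]_N) r : 0 < r -> open (cube x r).
Proof. by move=> r0; rewrite -ball_cube//; exact: ball_open. Qed.

Let cube_center (x : 'rV[R]_N) r : 0 < r -> cube x r x.
Proof. by move=> r0 i; rewrite subrr normr0. Qed.

Let cube_sub (x y : 'rV[R]_N) r : cube x r y ->
  exists2 s, 0 < s & cube y s `<=` cube x r.
Proof.
move=> xy; case: (ltP 0 r) => [r0|r0]; last first.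
  exists 1 => // w _ i; have := xy i.
  by move=> /(le_lt_trans (normr_ge0 _)); rewrite ltNge r0.
have /nbhs_ballP[s /= s0 sr] := open_nbhs_nbhs (conj (@open_cube x r r0) xy).
by exists s => //; rewrite -ball_cube.
Qed.

Let open_cube_sub (A : set 'rV[R]_N) x : open A -> A x ->
  exists2 s, 0 < s & cube x s `<=` A.
Proof.
move=> oA Ax; have /nbhs_ballP[s /= s0 sA] := open_nbhs_nbhs (conj oA Ax).
by exists s => //; rewrite -ball_cube.
Qed.

Let cube_le (x : 'rV[R]_N) r s : r <= s -> cube x r `<=` cube x s.
Proof. by move=> rs y xy i; exact: lt_le_trans (xy i) rs. Qed.

(** At an interior point a cube suffices; at a boundary point the piece is pushed into a cube around
    the interior point x + z. *)
Lemma poincare_on_local x : closure Omega x ->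
  exists2 r, 0 < r & poincare_on Omega (Omega `&` cube x r).
Proof.
move=> clx; have [Ox|nOx] := pselect (Omega x).
  have [r r0 rO] := open_cube_sub oO Ox; exists r => //.
  by rewrite setIidr//; exact: poincare_on_cube.
have [|r [z [r0 Oz push]]] := @lipschitz_boundary_push _ _ _ x lipO.
  by split => // /interior_subset.
have [s s0 sO] := open_cube_sub oO Oz.
have rs0 : 0 < Num.min r s by rewrite lt_min r0.
exists (Num.min r s) => //.
apply: (poincare_on_shift oO finO (G := cube (x + z) s) (z := z)).
- by apply: openI => //; exact: open_cube.
- by move=> y [].
- by move=> y t [Oy yr]; apply: push => //; apply: cube_le yr; rewrite ge_min lexx.
- move=> y [_ yr] i; rewrite !mxE opprD addrACA subrr addr0.
  by rewrite (lt_le_trans (yr i))// ge_min lexx orbT.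
- exact: poincare_on_cube.
Qed.

Lemma poincare_on_domain : poincare_on Omega Omega.
Proof.
have [[p Op] _ conO] := dO.
have [b b0 bOm] := open_cube_sub oO Op.
set B := cube p b in bOm.
have pB : poincare_on Omega B by exact: poincare_on_cube.
have mcO x r : measurable (Omega `&` cube x r) by apply: measurableI => //; exact: measurable_cube.
have mB : measurable B by exact: measurable_cube.
(* Each piece is attached to the fixed cube B from the start. Any two pieces then overlap in B, and
   chains are replaced by showing that S is open and closed relative to Omega. *)
pose S x := exists2 r, 0 < r & poincare_on Omega ((Omega `&` cube x r) `|` B).
have Ssub x r y : poincare_on Omega ((Omega `&` cube x r) `|` B) -> cube x r y -> S y.
  move=> xr /cube_sub[s s0 sr]; exists s => //.
  apply: (poincare_onS oO finO _ _ xr); first exact: measurableU.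
  by apply: setSU; exact: setIS.
(* The cubes at x and at y meet in an open part of Omega containing y, hence in positive measure, so
   the piece at x can be glued to the piece of y. *)
have Sstep x : closure Omega x ->
    (forall r, 0 < r -> exists2 y, S y & (Omega `&` cube x r) y) -> S x.
  move=> clx near_x; have [r r0 rP] := poincare_on_local clx.
  have [y [s s0 sP] [Oy xy]] := near_x r r0.
  exists r => //; apply: (poincare_onS oO finO _ _ (poincare_onU oO finO _ rP sP)).
  - exact: measurableU.
  - by move=> w [?|?]; [left|right; right].
  - apply: (@lt_le_trans _ _ (leb (Omega `&` (cube x r `&` cube y s)))).
      apply: lebesgue_rV_open_gt0.
        by apply: openI => //; apply: openI; exact: open_cube.
      by exists y; split => //; split => //; exact: cube_center.
    apply: le_measure; rewrite ?inE.
    + by apply: measurableI => //; apply: measurableI; exact: measurable_cube.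
    + by apply: measurableI => //; exact: measurableU.
    + by move=> w [Ow [xw yw]]; split => //; left.
have OS : Omega `&` S = Omega.
  apply: conO.
  - exists p; split => //; exists b => //; rewrite setUidr//; exact: subIsetr.
  - exists (\bigcup_(xr in [set xr : 'rV[R]_N * R | 0 < xr.2 /\
        poincare_on Omega ((Omega `&` cube xr.1 xr.2) `|` B)]) cube xr.1 xr.2).
      by apply: bigcup_open => -[x r] [r0 _]; exact: open_cube.
    apply/seteqP; split => x.
      move=> [Ox [r r0 rP]]; split => //; exists (x, r) => //; exact: cube_center.
    by move=> [Ox [[y r] [r0 rP] yx]]; split => //; exact: Ssub rP yx.
  - exists (closure (Omega `&` S)); first exact: closed_closure.
    apply/seteqP; split => x.
      by move=> OSx; split; [case: OSx|exact: subset_closure].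
    move=> [Ox clx]; split => //; apply: Sstep; first exact: subset_closure.
    move=> r r0; have [|y [[Oy Sy] xy]] := clx (cube x r).
      by rewrite -ball_cube//; exact: nbhsx_ballx.
    by exists y.
(* Omega is now contained in S, so [Sstep] also reaches the boundary points. *)
have clS x : closure Omega x -> S x.
  move=> clx; apply: Sstep => // r r0; have [|y [Oy xy]] := clx (cube x r).
    by rewrite -ball_cube//; exact: nbhsx_ballx.
  by exists y => //; move: Oy; rewrite -{1}OS => -[].
have cO : compact (closure Omega).
  have [M [_ /(_ (M + 1))]] := bO; rewrite ltrDl ltr01 => /(_ isT) OM.
  have cc := @closed_cube_compact R N 0 (M + 1).
  apply: (subclosed_compact _ cc); first exact: closed_closure.
  have -> : closed_cube (0 : 'rV[R]_N) (M + 1) = closure (closed_cube 0 (M + 1)).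
    by apply/closure_id; exact: compact_closed.
  apply: closureS => x Ox i; rewrite mxE subr0.
  exact: le_trans (normr_coord_le x i) (OM _ Ox).
have /choice[r_ r_P] (x : 'rV[R]_N) : exists r, 0 < r /\ (closure Omega x ->
    poincare_on Omega ((Omega `&` cube x r) `|` B)).
  have [clx|nclx] := pselect (closure Omega x); last by exists 1.
  by have [r r0 rP] := clS _ clx; exists r.
move: cO; rewrite compact_cover => /(_ _ (closure Omega) (fun x => cube x (r_ x))).
case.
- by move=> x _; apply: open_cube; case: (r_P x).
- by move=> x clx; exists x => //; apply: cube_center; case: (r_P x).
move=> F Fcl covF.
suff [C CP OC] : exists2 C, poincare_on Omega C & Omega `<=` C by exact: (poincare_onS oO finO mO OC CP).
(* Starting the union at B makes every partial union overlap the next piece at least in B. *)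
pose C s := \big[setU/B]_(x <- s) (Omega `&` cube x (r_ x)).
exists (C (finmap.enum_fset F)); last first.
  move=> x Ox; have [y yF xy] := covF x (subset_closure Ox).
  have {}yF : y \in finmap.enum_fset F by exact: yF.
  move: yF; rewrite /C; elim: (finmap.enum_fset F) => [|a s IH]; first by rewrite in_nil.
  rewrite big_cons inE => /orP[/eqP <-|ys]; [by left|right; exact: IH].
have : forall x, x \in finmap.enum_fset F -> closure Omega x.
  by move=> x /Fcl; rewrite inE.
rewrite /C; elim: (finmap.enum_fset F) => [_|a s IH sP]; first by rewrite big_nil.
have {}IH := IH (fun x xs => sP x (@mem_behead _ (a :: s) x xs)).
have [_ /(_ (sP a (mem_head _ _))) aP] := r_P a.
rewrite big_cons; set X := \big[_/_]_(_ <- _) _ in IH *.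
have BX : B `<=` X.
  rewrite /X; elim: (s) => [|c l IHl]; first by rewrite big_nil.
  by rewrite big_cons => x Bx; right; exact: IHl.
apply: (poincare_onS oO finO _ _ (poincare_onU oO finO _ aP IH)).
- by case: IH => mX _ _; exact: measurableU.
- by move=> x [?|?]; [left; left|right].
- apply: (@lt_le_trans _ _ (leb B)).
    by apply: lebesgue_rV_open_gt0; [exact: open_cube|exists p; exact: cube_center].
  apply: le_measure; rewrite ?inE//.
    by case: IH => mX _ _; apply: measurableI => //; exact: measurableU.
  by move=> x Bx; split; [right|exact: BX].
Qed.

Lemma poincare_wirtinger : exists C, 0 <= C /\ forall u, H1 Omega u ->
  exists k, \int[leb]_(x in Omega) (u x - k) ^+ 2 <= C * energy Omega u.
Proof. by case: poincare_on_domain. Qed.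

End poincare.

(** * Convergence of the gradients *)

Section weighted_convergence.
Context d (T : measurableType d) (R : realType).
Context (mu : {measure set T -> \bar R}) (D : set T) (mD : measurable D).

Lemma integrable_boundedM (C : R) (f h : T -> R) : measurable_fun D f ->
  (forall x, D x -> `|f x| <= C) -> mu.-integrable D (EFin \o h) ->
  mu.-integrable D (EFin \o (fun x => f x * h x)).
Proof.
move=> mf fC ih; have mh : measurable_fun D h by have /integrableP[/measurable_EFinP] := ih.
have iC : mu.-integrable D (EFin \o (fun x => C * `|h x|)).
  exact: (integrableZl mD C (integrable_norm ih)).
apply: (le_integrable mD _ _ iC); first by apply/measurable_EFinP; exact: measurable_funM.
move=> x Dx; rewrite /= lee_fin normrM (le_trans _ (ler_norm _))//.
by rewrite ler_wpM2r// fC.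
Qed.

(* The weight h is truncated at level m; what exceeds m is small in L1. *)
Lemma cvg_Rintegral_sqr_weight (q : nat -> T -> R) (c : R) (h : T -> R) :
  (forall n, measurable_fun D (q n)) -> (forall n x, D x -> `|q n x| <= c) ->
  mu.-integrable D (EFin \o h) -> (forall x, D x -> 0 <= h x) ->
  (forall n, mu.-integrable D (EFin \o (fun x => `|q n x|))) ->
  \int[mu]_(x in D) `|q n x| @[n --> \oo] --> 0 ->
  \int[mu]_(x in D) (q n x ^+ 2 * h x) @[n --> \oo] --> 0.
Proof.
move=> mq qc ih h0 iq q0.
have mh : measurable_fun D h by have /integrableP[/measurable_EFinP] := ih.
pose f_ (m : nat) x := Num.max (h x - m%:R) 0.
have mf_ m : measurable_fun D (f_ m).
  by apply: measurable_maxr => //; exact: measurable_funB.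
have f_le m x : D x -> `|f_ m x| <= h x.
  move=> Dx; rewrite ger0_norm ?le_max ?lexx ?orbT// /f_ ge_max h0// andbT.
  by rewrite gerBl.
have if_ m : mu.-integrable D (EFin \o f_ m).
  apply: (le_integrable mD _ _ ih); first exact/measurable_EFinP.
  by move=> x Dx; rewrite /= lee_fin (le_trans (f_le m x Dx))// ler_norm.
have f_0 : \int[mu]_(x in D) f_ m x @[m --> \oo] --> 0.
  rewrite [X in _ --> X](_ : 0 = \int[mu]_(x in D) 0); last first.
    by rewrite (Rintegral_cst mu mD) mul0r.
  apply: (dominated_cvg_Rintegral mD mf_ _ ih) => // x Dx.
  apply: cvg_near_cst; near=> m; apply/eqP; rewrite /f_ max_r// subr_le0.
  by near: m; exact: nbhs_infty_ger.
(* From h <= m + f_m and |q| <= |c|: one factor |q| is kept against m, both are bounded against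
   f_m. *)
have le_n n m : \int[mu]_(x in D) (q n x ^+ 2 * h x) <=
    `|c| * m%:R * \int[mu]_(x in D) `|q n x| + `|c| ^+ 2 * \int[mu]_(x in D) f_ m x.
  rewrite -RintegralDM//; apply: le_Rintegral => //.
  - apply: (@integrable_boundedM (`|c| ^+ 2)) => //; first exact: measurable_funX.
    move=> x Dx; rewrite normrX ler_pXn2r ?nnegrE// (le_trans (qc n x Dx))//.
    exact: ler_norm.
  - exact: integrableDM.
  - move=> x Dx; rewrite -(real_normK (num_real (q n x))).
    have qx : `|q n x| <= `|c| by rewrite (le_trans (qc n x Dx))// ler_norm.
    have q_0 := normr_ge0 (q n x).
    have fx : h x <= m%:R + f_ m x.
      by rewrite /f_ -lerBlDl le_max lexx.
    have f0 : 0 <= f_ m x by rewrite /f_ le_max lexx orbT.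
    apply: (@le_trans _ _ (`|q n x| ^+ 2 * (m%:R + f_ m x))).
      by rewrite ler_wpM2l// sqr_ge0.
    rewrite mulrDr lerD//.
      rewrite expr2 -mulrA (mulrC _ m%:R) mulrA ler_wpM2r// -?mulrA.
      by rewrite ler_wpM2r.
    by rewrite ler_wpM2r// ler_pXn2r ?nnegrE.
apply/cvgrPdist_lt => e e0.
(* First m is fixed so that the tail term is at most e / 2, then n is taken large for that m. Adding
   1 keeps the denominators positive. *)
have c1 : 0 < `|c| ^+ 2 + 1 by rewrite ltr_wpDl ?sqr_ge0.
have /cvgrPdist_lt/(_ (e / 2 / (`|c| ^+ 2 + 1)))[|m _ /(_ m (leqnn m))] := f_0.
  by rewrite !divr_gt0.
rewrite sub0r normrN => fm.
have cm1 : 0 < `|c| * m%:R + 1 by rewrite ltr_wpDl ?mulr_ge0.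
have /cvgrPdist_lt/(_ (e / 2 / (`|c| * m%:R + 1))) := q0.
rewrite !divr_gt0// => /(_ isT); apply: filterS => n; rewrite !sub0r !normrN => qn.
rewrite ger0_norm; last by apply: Rintegral_ge0 => x Dx; rewrite mulr_ge0 ?sqr_ge0 ?h0.
apply: (le_lt_trans (le_n n m)).
have fm' : `|c| ^+ 2 * \int[mu]_(x in D) f_ m x <= e / 2.
  move: fm; rewrite ltr_pdivlMr// => fm; apply: (le_trans _ (ltW fm)).
  rewrite mulrC (le_trans (ler_norm _))// normrM ler_wpM2l//.
  by rewrite ger0_norm ?sqr_ge0// lerDl.
have qn' : `|c| * m%:R * \int[mu]_(x in D) `|q n x| < e / 2.
  move: qn; rewrite ltr_pdivlMr// => qn; apply: (le_lt_trans _ qn).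
  rewrite mulrC (le_trans (ler_norm _))// normrM ler_wpM2l//.
  by rewrite ger0_norm ?mulr_ge0// lerDl.
by rewrite (splitr e) ltr_leD.
Unshelve. all: by end_near. Qed.

End weighted_convergence.

(** * Energy estimates for the weak formulations *)

Section conductivity.
Context (R : realType) (N : nat) (Omega : set 'rV[R]_N).
Let leb := lebesgue_rV R N.
Context (oO : open Omega) (finO : (leb Omega < +oo)%E).
Let mO : measurable Omega := open_rV_measurable oO.
Implicit Types (u v w alpha beta : 'rV[R]_N -> R).

(* The bounds of Linfty_between hold almost everywhere; clamping makes them
   hold everywhere without changing any integral. *)
Definition clamp (b c : R) alpha x : R := Num.max b (Num.min c (alpha x)).

Lemma measurable_clamp b c alpha : measurable_fun Omega alpha ->
  measurable_fun Omega (clamp b c alpha).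
Proof.
by move=> ma; apply: measurable_maxr => //; exact: measurable_minr.
Qed.

Lemma clamp_itv b c alpha x : b <= c -> b <= clamp b c alpha x <= c.
Proof. by move=> bc; rewrite /clamp le_max lexx/= ge_max bc ge_min lexx. Qed.

Lemma clamp_ae b c alpha : Linfty_between Omega b c alpha ->
  {ae leb, forall x, Omega x -> alpha x = clamp b c alpha x}.
Proof.
move=> [_]; apply: filterS => x + Ox => /(_ Ox)/andP[bx xc].
by rewrite /clamp min_r// max_r.
Qed.

Lemma Rintegral_clamp b c alpha (h : 'rV[R]_N -> R) : Linfty_between Omega b c alpha ->
  measurable_fun Omega h ->
  \int[leb]_(x in Omega) (alpha x * h x) =
  \int[leb]_(x in Omega) (clamp b c alpha x * h x).
Proof.
move=> Lalpha mh; have [ma _] := Lalpha; apply: ae_eq_Rintegral => //.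
- exact: measurable_funM.
- by apply: measurable_funM => //; exact: measurable_clamp.
- by apply: filterS (clamp_ae Lalpha) => x + Ox => /(_ Ox) <-.
Qed.

Lemma cvg_L1_clamp b c (alpha_ : nat -> 'rV[R]_N -> R) alpha : b <= c ->
  (forall n, Linfty_between Omega b c (alpha_ n)) -> Linfty_between Omega b c alpha ->
  cvg_L1 Omega alpha_ alpha ->
  \int[leb]_(x in Omega) `|clamp b c (alpha_ n) x - clamp b c alpha x| @[n --> \oo] --> 0.
Proof.
move=> bc Ln L; rewrite /cvg_L1.
rewrite [X in X @ \oo --> _](_ : _ = fun n => (\int[leb]_(x in Omega)
    `|clamp b c (alpha_ n) x - clamp b c alpha x|%:E)%E); first by move/fine_cvg.
apply/funext => n; have [ma _] := L; have [mn _] := Ln n.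
apply: ae_eq_integral => //.
- by apply/measurable_EFinP; apply: measurableT_comp => //; exact: measurable_funB.
- apply/measurable_EFinP; apply: measurableT_comp => //.
  by apply: measurable_funB; exact: measurable_clamp.
- by apply: filterS2 (clamp_ae L) (clamp_ae (Ln n)) => x + + Ox => /(_ Ox) <- /(_ Ox) <-.
Qed.

(** Young's inequality in each coordinate, with the weight a kept on the gradient of u: there it
    will be small against a fixed integrable function. *)
Lemma grad_dotM_le (a e : R) u v x : 0 < e ->
  a * grad_dot Omega u v x <=
  (2 * e)^-1 * (a ^+ 2 * grad_dot Omega u u x) + e / 2 * grad_dot Omega v v x.
Proof.
move=> e0; rewrite /grad_dot !mulr_sumr -big_split/=; apply: ler_sum => i _.
set p := weak_partial _ _ u x; set r := weak_partial _ _ v x.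
rewrite -subr_ge0 (_ : _ - _ = (2 * e)^-1 * (a * p - e * r) ^+ 2); last by field; rewrite gt_eqF.
by rewrite mulr_ge0 ?sqr_ge0// invr_ge0 mulr_ge0// ltW.
Qed.

Lemma integrable_grad_dotM (c : R) beta u v : measurable_fun Omega beta ->
  (forall x, Omega x -> `|beta x| <= c) -> H1 Omega u -> H1 Omega v ->
  leb.-integrable Omega (EFin \o (fun x => beta x * grad_dot Omega u v x)).
Proof.
by move=> mb bc Hu Hv; exact: (integrable_boundedM mO mb bc (integrable_grad_dot oO Hu Hv)).
Qed.

Lemma integrable_grad_dot_sqrM (c : R) beta u v : measurable_fun Omega beta ->
  (forall x, Omega x -> `|beta x| <= c) -> H1 Omega u -> H1 Omega v ->
  leb.-integrable Omega (EFin \o (fun x => beta x ^+ 2 * grad_dot Omega u v x)).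
Proof.
move=> mb bc; apply: (@integrable_grad_dotM (`|c| ^+ 2)); first exact: measurable_funX.
move=> x Ox; rewrite normrX; apply: lerXn2r; rewrite ?nnegrE ?normr_ge0//.
exact: le_trans (bc x Ox) (ler_norm c).
Qed.

Lemma energy_coercive (b c : R) beta u : measurable_fun Omega beta ->
  (forall x, Omega x -> `|beta x| <= c) -> (forall x, Omega x -> b <= beta x) ->
  H1 Omega u -> b * energy Omega u <= \int[leb]_(x in Omega) (beta x * grad_dot Omega u u x).
Proof.
move=> mb bc bb Hu; have ig := integrable_grad_dot oO Hu Hu.
rewrite /energy -(RintegralZl b mO ig).
apply: (le_Rintegral mO (integrableZl mO b ig) (integrable_grad_dotM mb bc Hu Hu)).
by move=> x Ox; rewrite ler_wpM2r; [|exact: grad_dot_ge0|exact: bb].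
Qed.

Lemma Rintegral_grad_dotM_le (c e : R) beta u v : 0 < e -> measurable_fun Omega beta ->
  (forall x, Omega x -> `|beta x| <= c) -> H1 Omega u -> H1 Omega v ->
  \int[leb]_(x in Omega) (beta x * grad_dot Omega u v x) <=
  (2 * e)^-1 * \int[leb]_(x in Omega) (beta x ^+ 2 * grad_dot Omega u u x) +
  e / 2 * energy Omega v.
Proof.
move=> e0 mb bc Hu Hv; have iv := integrable_grad_dot oO Hv Hv.
have iu := integrable_grad_dot_sqrM mb bc Hu Hu.
rewrite /energy -(RintegralDM mO _ _ iu iv).
apply: (le_Rintegral mO (integrable_grad_dotM mb bc Hu Hv) (integrableDM mO _ _ iu iv)).
by move=> x _; exact: grad_dotM_le.
Qed.

Lemma Rintegral_grad_dot_lin (a c : R) beta u v w : measurable_fun Omega beta ->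
  (forall x, Omega x -> `|beta x| <= c) -> H1 Omega u -> H1 Omega v -> H1 Omega w ->
  \int[leb]_(x in Omega) (beta x * grad_dot Omega w (fun x => a * u x + v x) x) =
  a * \int[leb]_(x in Omega) (beta x * grad_dot Omega w u x) +
  \int[leb]_(x in Omega) (beta x * grad_dot Omega w v x).
Proof.
move=> mb bc Hu Hv Hw.
have iu := integrable_grad_dotM mb bc Hw Hu; have iv := integrable_grad_dotM mb bc Hw Hv.
rewrite -[X in _ = _ + X]mul1r -(RintegralDM mO _ _ iu iv).
apply: ae_eq_Rintegral => //.
- by apply: measurable_funM => //; apply: measurable_grad_dot => //; exact: H1_lin.
- by have /integrableP[/measurable_EFinP] := integrableDM mO a 1 iu iv.
- apply: filterS (grad_dot_lin oO finO a w Hu Hv) => x + Ox => /(_ Ox) ->.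
  by rewrite mul1r mulrDr mulrCA.
Qed.

(* Testing the difference of the two weak formulations with w1 - w. *)
Lemma energy_sub_le (b c : R) beta1 beta w1 w : 0 < b ->
  measurable_fun Omega beta1 -> measurable_fun Omega beta ->
  (forall x, b <= beta1 x <= c) -> (forall x, b <= beta x <= c) ->
  H1 Omega w1 -> H1 Omega w ->
  (forall v, H1 Omega v -> \int[leb]_(x in Omega) (beta1 x * grad_dot Omega w1 v x) =
    \int[leb]_(x in Omega) (beta x * grad_dot Omega w v x)) ->
  energy Omega (fun x => -1 * w x + w1 x) <=
  b ^- 2 * \int[leb]_(x in Omega) ((beta1 x - beta x) ^+ 2 * grad_dot Omega w w x).
Proof.
(* Young's parameter is b itself: half of the coercive term b p is absorbed on the left. *)
move=> b0; have arith (p r : R) :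
    b * p <= (2 * b)^-1 * r + b / 2 * p -> p <= b ^- 2 * r.
  move=> h; have {}h : b / 2 * p <= (2 * b)^-1 * r by move: h; set y := _ * r; lra.
  have -> : p = 2 / b * (b / 2 * p) by field; rewrite gt_eqF.
  have -> : b ^- 2 * r = 2 / b * ((2 * b)^-1 * r) by field; rewrite gt_eqF.
  by rewrite ler_wpM2l// divr_ge0// ltW.
move=> mb1 mb b1c bc Hw1 Hw wE; set v := fun x => -1 * w x + w1 x.
have Hv : H1 Omega v by exact: H1_lin.
have norm_c g : (forall x, b <= g x <= c) -> forall x, Omega x -> `|g x| <= c.
  move=> gc x _; have /andP[h1 h2] := gc x.
  by rewrite ger0_norm// (le_trans _ h1)// ltW.
have qc x : Omega x -> `|beta x - beta1 x| <= c.
  move=> _; have /andP[h1 h2] := b1c x; have /andP[h3 h4] := bc x.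
  by rewrite ler_norml; apply/andP; split; lra.
have mq : measurable_fun Omega (fun x => beta x - beta1 x) by exact: measurable_funB.
have h1 := energy_coercive mb1 (norm_c _ b1c) (fun x _ => proj1 (andP (b1c x))) Hv.
have h2 := Rintegral_grad_dotM_le b0 mq qc Hw Hv.
(* Expand one factor v as w1 - w and replace the w1 term by means of the weak equation; only the
   difference of the weights remains, against the fixed w. *)
have E : \int[leb]_(x in Omega) (beta1 x * grad_dot Omega v v x) =
    \int[leb]_(x in Omega) ((beta x - beta1 x) * grad_dot Omega w v x).
  rewrite {1}/v (Rintegral_grad_dot_lin _ mb1 (norm_c _ b1c) Hw Hw1 Hv).
  under eq_Rintegral do rewrite grad_dotC.
  under [X in _ + X]eq_Rintegral do rewrite grad_dotC.
  rewrite (wE v Hv) mulN1r addrC -RintegralB//.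
  + by apply: eq_Rintegral => x _; rewrite mulrBl.
  + exact: integrable_grad_dotM mb (norm_c _ bc) Hw Hv.
  + exact: integrable_grad_dotM mb1 (norm_c _ b1c) Hw Hv.
rewrite E in h1; under eq_Rintegral do rewrite -sqrrN opprB.
exact: arith (le_trans h1 h2).
Qed.

Lemma energy_sub_cvg (b c : R) (beta_ : nat -> 'rV[R]_N -> R) beta
    (w_ : nat -> 'rV[R]_N -> R) w : 0 < b ->
  (forall n, measurable_fun Omega (beta_ n)) -> measurable_fun Omega beta ->
  (forall n x, b <= beta_ n x <= c) -> (forall x, b <= beta x <= c) ->
  \int[leb]_(x in Omega) `|beta_ n x - beta x| @[n --> \oo] --> 0 ->
  (forall n, H1 Omega (w_ n)) -> H1 Omega w ->
  (forall n v, H1 Omega v -> \int[leb]_(x in Omega) (beta_ n x * grad_dot Omega (w_ n) v x) =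
    \int[leb]_(x in Omega) (beta x * grad_dot Omega w v x)) ->
  energy Omega (fun x => -1 * w x + w_ n x) @[n --> \oo] --> 0.
Proof.
move=> b0 mb_ mb b_c bc bL1 Hw_ Hw wE.
pose I n := \int[leb]_(x in Omega) ((beta_ n x - beta x) ^+ 2 * grad_dot Omega w w x).
have q_c n x : Omega x -> `|beta_ n x - beta x| <= c.
  move=> _; have /andP[h1 h2] := b_c n x; have /andP[h3 h4] := bc x.
  by rewrite ler_norml; apply/andP; split; lra.
have mq n : measurable_fun Omega (fun x => beta_ n x - beta x) by exact: measurable_funB.
have iq n : leb.-integrable Omega (EFin \o (fun x => `|beta_ n x - beta x|)).
  apply: integrable_norm; apply: (sqi_integrable1 mO finO).
  exact: (sqi_bounded mO finO (mq n) (q_c n)).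
have I0 : I n @[n --> \oo] --> 0.
  exact: (cvg_Rintegral_sqr_weight mO mq q_c (integrable_grad_dot oO Hw Hw)
    (fun x _ => grad_dot_ge0 Omega w x) iq bL1).
apply: (@squeeze_cvgr _ _ _ _ (fun=> 0) (fun n => b ^- 2 * I n)).
- apply: nearW => n; rewrite energy_ge0/=.
  exact: (energy_sub_le b0 (mb_ n) mb (b_c n) bc (Hw_ n) Hw (wE n)).
- exact: cvg_cst.
- by rewrite -[X in _ --> X](mulr0 (b ^- 2)); apply: cvgM => //; exact: cvg_cst.
Qed.

(** Young's inequality for beta and for - beta bounds the absolute value of the pairing. *)
Lemma cvg_energy_pairing (c : R) beta (d_ : nat -> 'rV[R]_N -> R) w :
  measurable_fun Omega beta -> (forall x, Omega x -> `|beta x| <= c) ->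
  (forall n, H1 Omega (d_ n)) -> H1 Omega w ->
  energy Omega (d_ n) @[n --> \oo] --> 0 ->
  \int[leb]_(x in Omega) (beta x * grad_dot Omega w (d_ n) x) @[n --> \oo] --> 0.
Proof.
move=> mb bc Hd Hw dE.
pose J := \int[leb]_(x in Omega) (beta x ^+ 2 * grad_dot Omega w w x).
have J0 : 0 <= J.
  by apply: Rintegral_ge0 => x _; rewrite mulr_ge0 ?sqr_ge0 ?grad_dot_ge0.
have mNb : measurable_fun Omega (fun x => - beta x) by exact: measurable_funN.
have Nbc x : Omega x -> `|- beta x| <= c by rewrite normrN; exact: bc.
apply/cvgrPdist_lt => e e0.
(* This parameter makes the fixed term J / (2 t) at most e / 2; the other term is small once the
   energy is below e / t. The added 1 covers J = 0. *)
pose t := (J + 1) / e.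
have J1 : 0 < J + 1 by rewrite ltr_wpDl.
have t0 : 0 < t by rewrite divr_gt0.
have /cvgrPdist_lt/(_ (e / t)) := dE.
rewrite divr_gt0// => /(_ isT); apply: filterS => n.
rewrite !sub0r !normrN ger0_norm ?energy_ge0// => En.
have h1 : (2 * t)^-1 * J <= e / 2.
  rewrite (_ : (2 * t)^-1 * J = e / 2 * (J / (J + 1))); last by rewrite /t; field; rewrite !gt_eqF.
  by rewrite ler_piMr ?ler_pdivrMr ?mul1r ?lerDl// divr_ge0// ltW.
have h2 : t / 2 * energy Omega (d_ n) < e / 2.
  have -> : e / 2 = t / 2 * (e / t) by field; rewrite gt_eqF.
  by rewrite ltr_pM2l// divr_gt0.
have b1 := Rintegral_grad_dotM_le t0 mb bc Hw (Hd n).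
have := Rintegral_grad_dotM_le t0 mNb Nbc Hw (Hd n).
under [in X in _ <= X]eq_Rintegral do rewrite sqrrN.
under eq_Rintegral do rewrite mulNr -mulN1r.
rewrite (RintegralZl _ mO (integrable_grad_dotM mb bc Hw (Hd n))) => b2.
move: b1 b2 h1 h2; rewrite -/J; set X := \int[_]_(_ in _) _.
set Y := _ * J; set Z := _ * energy _ _ => b1 b2 h1 h2.
by rewrite ltr_norml; apply/andP; split; lra.
Qed.

Lemma H1R_norm_ge0 u : 0 <= H1R_norm Omega u.
Proof.
apply: lb_le_inf; first by exists (H1_norm Omega (fun x => u x - 0)); exists 0.
by move=> _ [k _ <-]; exact: sqrtr_ge0.
Qed.

(** The constant k is admissible in the infimum, and subtracting it does not change the energy. *)
Lemma H1R_norm_le (C k : R) u : H1 Omega u ->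
  \int[leb]_(x in Omega) (u x - k) ^+ 2 <= C * energy Omega u ->
  H1R_norm Omega u <= Num.sqrt ((C + 1) * energy Omega u).
Proof.
move=> Hu uC; apply: (@le_trans _ _ (H1_norm Omega (fun x => u x - k))).
  apply: ge_inf; last by exists k.
  by exists 0 => _ [l _ <-]; exact: sqrtr_ge0.
apply: ler_wsqrtr; rewrite mulrDl mul1r.
by apply: lerD uC _; rewrite (Rintegral_grad_dot_subr oO finO k Hu).
Qed.

End conductivity.

(** * Convergence of the solutions and of their energies *)

Theorem proposition2 (R : realType) (N : nat) (hN : N = 2%N \/ N = 3%N)
    (Omega : set 'rV[R]_N)
    (domain_Omega : domain Omega) (bounded_Omega : bounded_set Omega)
    (lipschitz_Omega : lipschitz_boundary Omega)
    (b c : R) (b_gt0 : 0 < b) (b_lt_c : b < c)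
    (alpha_ : nat -> 'rV[R]_N -> R) (alpha : 'rV[R]_N -> R)
    (alpha_n_bc : forall n, Linfty_between Omega b c (alpha_ n))
    (alpha_bc : Linfty_between Omega b c alpha)
    (alpha_L1 : cvg_L1 Omega alpha_ alpha)
    (alpha_weak_star : weak_star_cvg_Linfty Omega alpha_ alpha)
    (g : ('rV[R]_N -> R) -> R) (g_Hmhalf : Hmhalf Omega g)
    (g_1 : g (fun=> 1) = 0)
    (w_ : nat -> 'rV[R]_N -> R) (w : 'rV[R]_N -> R)
    (w_n_sol : forall n, neumann_solution Omega (alpha_ n) g (w_ n))
    (w_sol : neumann_solution Omega alpha g w) :
  weakly_cvg_H1R Omega w_ w /\
  \int[lebesgue_rV R N]_(x in Omega)
      (alpha_ n x * grad_dot Omega (w_ n) (w_ n) x) @[n --> \oo] -->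
  \int[lebesgue_rV R N]_(x in Omega) (alpha x * grad_dot Omega w w x).
Proof.
have oO : open Omega by case: domain_Omega.
have mO := open_rV_measurable oO.
have finO := lebesgue_rV_bounded mO bounded_Omega.
have [C [C0 poincare]] := poincare_wirtinger domain_Omega bounded_Omega lipschitz_Omega.
have bc := ltW b_lt_c.
have Hw_ n : H1 Omega (w_ n) by case: (w_n_sol n).
have [Hw w_weak] := w_sol.
have same_g n v : H1 Omega v ->
    \int[lebesgue_rV R N]_(x in Omega) (alpha_ n x * grad_dot Omega (w_ n) v x) =
    \int[lebesgue_rV R N]_(x in Omega) (alpha x * grad_dot Omega w v x).
  by move=> Hv; rewrite (w_weak v Hv); case: (w_n_sol n) => _; exact.
(* The shape a * u + v lets the linearity lemmas, and the linearity of functionals on H1/R, apply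
   literally. *)
pose d_ n x := -1 * w x + w_ n x.
have Hd n : H1 Omega (d_ n) by exact: H1_lin.
have d_cvg0 : energy Omega (d_ n) @[n --> \oo] --> 0.
  apply: (energy_sub_cvg oO finO (beta_ := fun n => clamp b c (alpha_ n))
    (beta := clamp b c alpha) b_gt0).
  - by move=> n; apply: measurable_clamp; case: (alpha_n_bc n).
  - by apply: measurable_clamp; case: alpha_bc.
  - by move=> n x; exact: clamp_itv.
  - by move=> x; exact: clamp_itv.
  - exact: cvg_L1_clamp.
  - exact: Hw_.
  - exact: Hw.
  - move=> n v Hv.
    rewrite -(Rintegral_clamp oO (alpha_n_bc n) (measurable_grad_dot oO (Hw_ n) Hv)).
    by rewrite -(Rintegral_clamp oO alpha_bc (measurable_grad_dot oO Hw Hv)) same_g.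
have w_nE n : w_ n = fun x => 1 * d_ n x + w x.
  by apply/funext => x; rewrite /d_; ring.
split.
- move=> l [l_lin [K lK]].
  (* The differences tend to 0 in the quotient norm, and l is bounded for it. The bound K carries no
     sign, hence |K|. *)
  have ld0 : l (d_ n) @[n --> \oo] --> 0.
    apply/norm_cvg0P; apply: (@squeeze_cvgr _ _ _ _ (fun=> 0)
      (fun n => `|K| * Num.sqrt ((C + 1) * energy Omega (d_ n)))).
    + apply: nearW => n; rewrite normr_ge0/= (le_trans (lK _ (Hd n)))//.
      apply: (@le_trans _ _ (`|K| * H1R_norm Omega (d_ n))).
        by rewrite ler_wpM2r ?H1R_norm_ge0// ler_norm.
      rewrite ler_wpM2l//; have [k dk] := poincare _ (Hd n).
      exact: (H1R_norm_le oO finO (Hd n) dk).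
    + exact: cvg_cst.
    + rewrite -[X in _ --> X](mulr0 `|K|); apply: cvgM; first exact: cvg_cst.
      have d0 : (C + 1) * energy Omega (d_ n) @[n --> \oo] --> 0.
        by rewrite -[X in _ --> X](mulr0 (C + 1)); apply: cvgM => //; exact: cvg_cst.
      rewrite -[X in _ --> X]sqrtr0.
      by apply: continuous_cvg d0; exact: sqrt_continuous.
  rewrite [X in X @ \oo --> _](_ : _ = fun n => l (d_ n) + l w); last first.
    by apply/funext => n; rewrite {1}w_nE (l_lin _ _ _ (Hd n) Hw) mul1r.
  by rewrite -[X in _ --> X]add0r; apply: cvgD => //; exact: cvg_cst.
- have mb : measurable_fun Omega (clamp b c alpha).
    by apply: measurable_clamp; case: alpha_bc.
  have bb x : Omega x -> `|clamp b c alpha x| <= c.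
    move=> _; have /andP[h1 h2] := clamp_itv alpha x bc.
    by rewrite ger0_norm// (le_trans (ltW b_gt0)).
  (* Testing with w_n trades alpha_n for alpha and one gradient of w_n for that of w; splitting w_n
     as d_n + w leaves a pairing with d_n that tends to 0. *)
  have E n : \int[lebesgue_rV R N]_(x in Omega)
      (alpha_ n x * grad_dot Omega (w_ n) (w_ n) x) =
      \int[lebesgue_rV R N]_(x in Omega) (clamp b c alpha x * grad_dot Omega w (d_ n) x) +
      \int[lebesgue_rV R N]_(x in Omega) (alpha x * grad_dot Omega w w x).
    rewrite (same_g n _ (Hw_ n)).
    rewrite (Rintegral_clamp oO alpha_bc (measurable_grad_dot oO Hw (Hw_ n))).
    rewrite (Rintegral_clamp oO alpha_bc (measurable_grad_dot oO Hw Hw)).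
    by rewrite [in LHS]w_nE (Rintegral_grad_dot_lin oO finO 1 mb bb (Hd n) Hw Hw) mul1r.
  rewrite (funext E).
  rewrite -[X in _ --> X]add0r; apply: cvgD; last exact: cvg_cst.
  exact: (cvg_energy_pairing oO mb bb Hd Hw d_cvg0).
Qed.
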